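(* Let $k\geq2$ be an integer and $\epsilon>0$. Let $\delta_2=\frac{105}{317}$ and, for $k\geq3$, $$\delta_k=\frac{1}{k+1}\left(1-\frac{3k^3-6k^2-k+4}{3k^5+15k^4+33k^3+21k^2+14k+10}\right).$$ Then for all $K\leq N$ with $K\gg N^{(\frac{k+1}{2})\delta_k+\epsilon}$ one has $$K^{\frac1k}\log K\ll\int_0^1|S_k(\alpha;K)|^{1+\frac1k}\,d\alpha\ll K^{\frac1k}(\log K)^{2-\frac1k}.$$
   Context: For an integer $k\ge 2$, $\mu_k(n)$ is the indicator function of the $k$-free integers, i.e. those divisible by no $k$th power of a prime. Write $e(\alpha)=e^{2\pi i\alpha}$, and for $1\le K\leq N$ set $$S_k(\alpha;K)=\sum_{N-K<n\leq N}\mu_k(n)e(n\alpha).$$ $K\gg N^\eta$ means $K\ge cN^\eta$ for a fixed constant $c>0$; the conclusion is asserted for $N$ sufficiently large, with implicit constants depending at most on $k$, $\epsilon$ and $c$. *)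

(* Defs.v *)
From mathcomp Require Import all_boot all_order all_algebra.
From mathcomp Require Import complex.
From mathcomp Require Import all_classical all_reals all_analysis.

Set Implicit Arguments.
Unset Strict Implicit.
Unset Printing Implicit Defensive.

Import Order.TTheory GRing.Theory Num.Theory.
Import numFieldNormedType.Exports.

Local Open Scope classical_set_scope.
Local Open Scope ring_scope.

(* 0 is not k-free for this predicate. *)
Definition kfree (k n : nat) : Prop :=
  forall p : nat, prime p -> ~~ (p ^ k %| n)%N.

Definition mu_k (R : realType) (k n : nat) : R := (`[< kfree k n >])%:R.

Definition e (R : realType) (alpha : R) : R[i] :=
  (cos (2 * pi * alpha) +i* sin (2 * pi * alpha))%C.

(* N and K are real; n ranges over nat, which loses nothing when K <= N,
   since then n > N - K >= 0. *)
Definition S_k (R : realType) (k : nat) (N K alpha : R) : R[i] :=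
  \sum_(0 <= n < (Num.truncn N).+1 | N - K < n%:R <= N)
    (mu_k R k n)%:C%C * e (n%:R * alpha).

(* normc is the R-valued modulus, whereas `|z| lives in R[i]. *)
Definition cmod (R : realType) (z : R[i]) : R := ComplexField.Normc.normc z.

Definition delta (R : realType) (k : nat) : R :=
  let x : R := k%:R in
  if k == 2%N then 105 / 317
  else (x + 1)^-1 *
    (1 - (3 * x ^+ 3 - 6 * x ^+ 2 - x + 4) /
         (3 * x ^+ 5 + 15 * x ^+ 4 + 33 * x ^+ 3 + 21 * x ^+ 2 + 14 * x + 10)).

Definition moment (R : realType) (k : nat) (N K : R) : R :=
  \int[@lebesgue_measure R]_(alpha in `[0, 1])
    (cmod (S_k k N K alpha) `^ (1 + k%:R^-1)).

(* Main.v *)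
Require Import Defs.
From mathcomp Require Import all_boot all_order all_algebra.
From mathcomp Require Import complex.
From mathcomp Require Import all_classical all_reals all_analysis.
From mathcomp Require Import measurable_realfun.
From mathcomp Require Import ring lra zify.

(** Let [u < n <= v] run over the integers of (N - K, N], let [H = v - u] be
their number, [S] the exponential sum and [p = 1 + 1/k].  Everything starts
from the identity mu_k(n) = sum of mu(d) over the [d] with d^k | n, and from
one arithmetic fact: few integers of the interval are divisible by the [k]-th
power of a large [d].

The arithmetic fact.  A modulus [l ^ k] below [H] has about [H / l ^ k]
multiples in the interval; one above [H] has at most one, and the issue is to
bound the number of [l] for which it has one by H^(2/(k+1)) times a negative
power of [v] ([count_has_multiple]).  Put Y for that bound.  The [l <= Y] are
free.  If l^k m lies in the interval with [l] large, then [m <= Y], and for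
each [m] the [l] are confined to a short interval.  What remains is a narrow
window around v^(1/(k+1)), the only place where counting trivially just fails
when [K] is slightly below the square root of [N].  There one compares two
neighbouring values [l] and [l + a]: the difference of the cofactors is close
to f(l) - f(l + a) with f(x) = v / x^k, and since [f] is convex this
expression takes values near a given integer only for [l] in a short range
([count_has_multiple_pairs]).  So close pairs are rare, hence most gaps are
large, hence there are few [l].  The exponent ((k+1)/2) delta_k is at least
1/2 - 1/(32(k+1)), and this is the range in which the argument applies.

Pairing the divisors [d] and [d'] of the same [n] through their least common
multiple, the arithmetic fact gives that the part of the sum with [d > D] has
mean square O(H D^(1-k)) for [D <= H^(1/(k+1))] ([second_moment]).

Upper bound.  The part with [d <= D] is a sum of [D] Dirichlet kernels, so its
mean modulus is O(D log H) ([int01_low]).  Given a level [lam], choose [D] with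
D^k = H / (lam log H): by Chebyshev's inequality, applied to the first part in
mean and to the second in mean square, the set where |S| > lam has measure
O(H^(1/k) (log H)^(1-1/k) lam^(-p)).  Hence each dyadic level between
H^(1/(k+1)) and [H] contributes O(H^(1/k) (log H)^(1-1/k)) to the [p]-th
moment, and there are O(log H) levels ([moment_upper]).

Lower bound.  Let [r] be squarefree and at most a small power of [H], and let
[a <= r^k] be [k]-free.  Immediately to the left of a / r^k the terms with
r | d add up to about H / r^k, with no cancellation because the first of them
dominates, while the others are small: |S| >= H / (16 r^k)
([pointwise_lower]).  These arcs are disjoint, of length about 1/H, and a
positive proportion of all [a] is admissible, so that [r] contributes about
r^k (H / r^k)^p / H = H^(1/k) / r.  Summing 1/r over squarefree [r] produces
the logarithm ([moment_lower]). *)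

Import Order.TTheory GRing.Theory Num.Theory.
Import numFieldNormedType.Exports.

Local Open Scope ring_scope.

Set Implicit Arguments.
Unset Strict Implicit.
Unset Printing Implicit Defensive.

(** * Moebius function and k-free integers *)

Lemma sum_multiples (V : nmodType) (q X : nat) (P : pred nat) (F : nat -> V) :
  (0 < q)%N ->
  \sum_(0 <= n < X | P n && (q %| n)%N) F n =
  \sum_(0 <= m < X | P (q * m)%N && (q * m < X)%N) F (q * m)%N.
Proof.
move=> q0.
rewrite -big_filter -[RHS]big_filter.
rewrite -(big_map (muln q) xpredT F); apply: perm_big; apply: uniq_perm.
- by rewrite filter_uniq ?iota_uniq.
- rewrite map_inj_uniq ?filter_uniq ?iota_uniq// => a b /eqP.
  by rewrite eqn_pmul2l// => /eqP.
move=> n; rewrite mem_filter mem_index_iota /=.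
apply/idP/mapP => [/andP[/andP[Pn /dvdnP[m nm]] nX]|[m]].
  exists m; rewrite ?nm 1?mulnC// mem_filter mem_index_iota /= mulnC -nm Pn nX/=.
  by rewrite (leq_ltn_trans _ nX)// nm leq_pmulr.
rewrite mem_filter mem_index_iota => /andP[/andP[Pm mX] _] ->.
by rewrite Pm mX dvdn_mulr.
Qed.

Lemma leq_expl k d : (0 < k)%N -> (d <= d ^ k)%N.
Proof. by case: d k => [|d] [|k]// _; rewrite expnS leq_pmulr// expn_gt0. Qed.

Lemma kfree_gt0 k n : kfree k n -> (0 < n)%N.
Proof. by case: n => // /(_ 2%N isT); rewrite dvdn0. Qed.

(** This also shows that a squarefree integer is determined by its prime
    divisors. *)
Lemma kfree2_dvdn r d : kfree 2 r ->
  (forall p, prime p -> (p %| r)%N -> (p %| d)%N) -> (r %| d)%N.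
Proof.
move=> fr H; have r0 := kfree_gt0 fr.
apply/dvdn_partP => // p; rewrite mem_primes => /and3P[pp _ pr].
rewrite p_part (_ : logn p r = 1%N) ?expn1 ?H//.
apply/eqP; rewrite eqn_leq logn_gt0 mem_primes pp r0 pr andbT leqNgt.
by rewrite -pfactor_dvdn// fr.
Qed.

Lemma kfree2_primeM p d : prime p -> ~~ (p %| d)%N ->
  kfree 2 (p * d) <-> kfree 2 d.
Proof.
move=> pp pd; split=> fd q pq; first by apply: contra (fd q pq) => /dvdn_mull ->.
have [->|qp] := eqVneq q p; first by rewrite expnS expn1 dvdn_pmul2l ?prime_gt0.
rewrite Gauss_dvdr ?fd// coprimeXl// prime_coprime// dvdn_prime2//.
Qed.

Definition mobius (R : realType) (n : nat) : R :=
  if `[< kfree 2 n >] then (-1) ^+ size (primes n) else 0.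

Section Mobius.
Variable R : realType.
Implicit Types k n d p : nat.
Local Notation mob := (mobius R).

Lemma mobius_norm_le1 n : `|mob n| <= 1.
Proof. by rewrite /mobius; case: ifP => _; rewrite ?normr0// normrX normrN1 expr1n. Qed.

Lemma mobius_norm1 n : kfree 2 n -> `|mob n| = 1.
Proof. by move=> fn; rewrite /mobius asboolT// normrX normrN1 expr1n. Qed.

Lemma mobius1 : mob 1 = 1.
Proof.
rewrite /mobius asboolT// => p pp; rewrite dvdn1 -[1%N]/(1 ^ 2)%N eqn_exp2r//.
by apply: contraL pp => /eqP ->.
Qed.

Lemma mobius_primeM p d : prime p -> ~~ (p %| d)%N -> mob (p * d) = - mob d.
Proof.
move=> pp pd; rewrite /mobius (_ : `[< kfree 2 (p * d) >] = `[< kfree 2 d >]); last first.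
  by apply/asbool_equiv_eq/kfree2_primeM.
case: asboolP => fd; last by rewrite oppr0.
have d0 := kfree_gt0 fd.
have /perm_size -> : perm_eq (primes (p * d)) (p :: primes d).
  apply: uniq_perm; rewrite ?primes_uniq//= ?mem_primes ?(negPf pd) ?andbF ?primes_uniq//.
  by move=> q; rewrite primesM ?(prime_gt0 pp)// (primes_prime pp) !inE.
by rewrite /= exprS mulN1r.
Qed.

Lemma mobius_primeM0 p d : prime p -> (p %| d)%N -> mob (p * d) = 0.
Proof.
move=> pp pd; rewrite /mobius asboolF// => /(_ p pp).
by rewrite expnS expn1 dvdn_pmul2l ?pd ?prime_gt0.
Qed.

(** If p^k | n for a prime [p], then [d] and [p * d] cancel for every
    squarefree [d] prime to [p] with d^k | n; if [n] is k-free only [d = 1]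
    remains. *)
Lemma mu_k_sum k n v : (0 < k)%N -> (0 < n <= v)%N ->
  mu_k R k n = \sum_(1 <= d < v.+1 | (d ^ k %| n)%N) mob d.
Proof.
move=> k0 /andP[n0 nv].
have dle d : (d ^ k %| n)%N -> (d <= n)%N.
  by move=> /dvdn_leq dn; apply: leq_trans (dn n0); apply: leq_expl.
have [fn|nfn] := boolP `[< kfree k n >].
  rewrite /mu_k fn /= (big_rem 1%N)/= ?mem_index_iota//= ?exp1n ?dvd1n; last first.
    by rewrite ltnS (leq_trans n0).
  rewrite mobius1 big_seq_cond big1 ?addr0// => d.
  rewrite mem_rem_uniq ?iota_uniq// !inE mem_index_iota => /andP[/andP[d1 /andP[d0 _]] dn].
  have d2 : (1 < d)%N by rewrite ltn_neqAle eq_sym d1.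
  have := asboolW fn _ (pdiv_prime d2).
  by rewrite (dvdn_trans _ dn)// dvdn_exp2r ?pdiv_dvd.
rewrite /mu_k (negPf nfn) /=.
have [p [pp pn]] : exists p, prime p /\ (p ^ k %| n)%N.
  move: nfn => /asboolPn/existsNP[p /not_implyP[pp /negP]]; rewrite negbK => pn.
  by exists p.
have zero (P : pred nat) : ~~ P 0%N ->
    \sum_(1 <= d < v.+1 | P d) mob d = \sum_(0 <= d < v.+1 | P d) mob d.
  by move=> P0; rewrite [RHS]big_ltn_cond// (negPf P0).
rewrite zero; last by rewrite exp0n// dvd0n -lt0n.
rewrite (bigID (fun d => p %| d)%N) /= sum_multiples ?prime_gt0//.
rewrite (bigID (fun d => p %| d)%N) /= big1 ?add0r => [|d /andP[_ pd]]; last first.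
  by rewrite mobius_primeM0.
apply/esym/eqP; rewrite addr_eq0 -sumrN; apply/eqP.
apply: eq_big => [d|d /andP[_ pd]]; last by rewrite mobius_primeM.
have [_|pd] := boolP (p %| d)%N; rewrite ?andbF// !andbT.
have cop : coprime (p ^ k) (d ^ k) by rewrite coprimeXl// coprimeXr// prime_coprime.
rewrite expnMn Gauss_dvd// pn /=; apply/andP/idP => [[]//|dn]; split=> //.
rewrite ltnS (leq_trans _ nv)// dle// expnMn Gauss_dvd// pn//.
Qed.

End Mobius.

(** * Elementary sums and counting by spacing *)

Section Sums.
Variable R : realType.
Implicit Types (k a b n X : nat) (P : pred nat).

(** The tangent to [x ^+ k.+1] at [y] lies below the graph.  Used at [x], [y]
    and at their inverses, it replaces all calculus on powers. *)
Lemma tangent_pow k (x y : R) : 0 <= x -> 0 <= y ->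
  y ^+ k.+1 + k.+1%:R * y ^+ k * (x - y) <= x ^+ k.+1.
Proof.
move=> x0 y0; elim: k => [|k IH]; first by rewrite !expr1 expr0; lra.
rewrite exprS [leRHS]exprS; have := ler_wpM2l x0 IH.
apply: le_trans; rewrite [k.+2%:R]mulrS.
rewrite -subr_ge0 (_ : _ - _ = k.+1%:R * y ^+ k * (x - y) ^+ 2); last by rewrite !exprS; ring.
by rewrite mulr_ge0 ?sqr_ge0// mulr_ge0 ?exprn_ge0.
Qed.

(** The value 3/4 matters only for being less than 1: it makes the first term
    of several divisor sums dominate the rest. *)
Lemma sum_invsq_ge2 X : \sum_(2 <= d < X.+3) (d%:R ^- 2 : R) <= 3 / 4 - X.+2%:R^-1.
Proof.
elim: X => [|X IH]; first by rewrite big_nat1; lra.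
rewrite big_nat_recr //=; move: IH.
have x0 : 0 < X.+2%:R :> R by rewrite ltr0n.
have -> : X.+3%:R = X.+2%:R + 1 :> R by rewrite -natr1.
move: X.+2%:R x0 => x x0.
suff : (x + 1) ^- 2 <= x^-1 - (x + 1)^-1 by move=> ? ?; lra.
have -> : x^-1 - (x + 1)^-1 = (x * (x + 1))^-1 by field; apply/andP; split; apply/lt0r_neq0; lra.
rewrite lef_pV2 ?posrE; [|nra..]; nra.
Qed.

Lemma sum_invpow_ge2 k X : (2 <= k)%N ->
  \sum_(2 <= d < X) (d%:R ^- k : R) <= 3 / 4.
Proof.
move=> k2; apply: (@le_trans _ _ (\sum_(2 <= d < X) (d%:R ^- 2 : R))).
  apply: ler_sum_nat => d /andP[d2 _]; have d0 : (0 : R) < d%:R by rewrite ltr0n (leq_trans _ d2).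
  by rewrite lef_pV2 ?posrE ?exprn_gt0// ler_weXn2l// ler1n (leq_trans _ d2).
case: X => [|[|[|X]]]; [by rewrite big_geq//; lra..|].
by apply: le_trans (sum_invsq_ge2 X) _; rewrite gerBl invr_ge0.
Qed.

Lemma sum_invpow_tail k B X : (2 <= k)%N -> (0 < B)%N ->
  \sum_(B <= d < X) (d%:R ^- k : R) <= 2 * (B%:R / B%:R ^+ k).
Proof.
move=> k2 B0; have b0 : (0 : R) < B%:R by rewrite ltr0n.
have [XB|BX] := leqP X B; first by rewrite big_geq// mulr_ge0// divr_ge0// exprn_ge0.
have H2 : \sum_(B <= d < X) (d%:R ^- 2 : R) <= 2 * (B%:R^-1 - X%:R^-1).
  rewrite -(subnK (ltnW BX)); elim: (X - B)%N => [|n IH].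
    by rewrite big_geq// subrr mulr0.
  rewrite addSn big_nat_recr ?leq_addl//=; move: IH.
  have x0 : (0 : R) < (n + B)%:R by rewrite ltr0n addn_gt0 B0 orbT.
  have x1 : (1 : R) <= (n + B)%:R by rewrite ler1n addn_gt0 B0 orbT.
  have -> : (n + B).+1%:R = (n + B)%:R + 1 :> R by rewrite -natr1.
  move: (n + B)%:R x0 x1 => x x0 x1.
  suff : x ^- 2 <= 2 * (x^-1 - (x + 1)^-1) by move=> ? ?; lra.
  have -> : 2 * (x^-1 - (x + 1)^-1) = (x * (x + 1) / 2)^-1 by field; apply/andP; split; apply/lt0r_neq0; lra.
  have x2 : 0 < x + 1 by lra.
  rewrite lef_pV2 ?posrE ?exprn_gt0 ?divr_gt0 ?mulr_gt0//; nra.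
have -> : 2 * (B%:R / B%:R ^+ k) = B%:R ^- (k - 2) * (2 * B%:R^-1) :> R.
  rewrite -{1}(subnK k2) exprD; field.
  by rewrite expf_neq0 ?gt_eqF.
apply: (@le_trans _ _ (B%:R ^- (k - 2) * \sum_(B <= d < X) (d%:R ^- 2 : R))).
  rewrite mulr_sumr; apply: ler_sum_nat => d /andP[dB _].
  have d0 : (0 : R) < d%:R by rewrite ltr0n (leq_trans B0).
  rewrite -{1}(subnK k2) exprD invfM ler_pM2r ?invr_gt0 ?exprn_gt0//.
  by rewrite lef_pV2 ?posrE ?exprn_gt0// lerXn2r ?nnegrE ?ler_nat.
rewrite ler_pM2l ?invr_gt0 ?exprn_gt0//; apply: le_trans H2 _.
by rewrite ler_pM2l// gerBl invr_ge0.
Qed.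

Lemma sum1_countR (s : seq nat) P : \sum_(n <- s | P n) (1 : R) = (count P s)%:R.
Proof. by rewrite -sum1_count natr_sum. Qed.

Lemma count_diam a b P (B : R) : 0 <= B ->
  (forall x y, (a <= x < b)%N -> (a <= y < b)%N -> P x -> P y -> (x <= y)%N -> y%:R - x%:R <= B) ->
  \sum_(a <= n < b | P n) 1 <= B + 1.
Proof.
move=> B0 H; rewrite sum1_countR -size_filter.
set s := [seq n <- _ | _].
have sin x : (x \in s) = (P x && (a <= x < b)%N) by rewrite mem_filter mem_index_iota.
have [->|/hasP[x xs _]] : s = [::] \/ has xpredT s.
- by case: (s); [left|right].
- by rewrite addr_ge0.
have ex : exists n, n \in s by exists x.
pose m := ex_minn ex; have ms : m \in s by rewrite /m; case: ex_minnP.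
have mm y : y \in s -> (m <= y)%N by rewrite /m; case: ex_minnP => ? _; apply.
have sub : {subset s <= iota m (Num.truncn B).+1}.
  move=> y ys; rewrite mem_iota mm//= addnS ltnS -leq_subLR.
  have := ys; have := ms; rewrite !sin => /andP[Pm rm] /andP[Py ry].
  by rewrite truncn_ge_nat// natrB ?mm// H ?mm.
have /(uniq_leq_size)/(_ sub) : uniq s by rewrite filter_uniq ?iota_uniq.
rewrite size_iota -(ler_nat R) => /le_trans -> //.
by rewrite -natr1 lerD2r truncn_le.
Qed.

Lemma count_spaced b P (A : nat) : (0 < A)%N ->
  (forall x y, (x < b)%N -> (y < b)%N -> P x -> P y -> (x < y)%N -> (x + A <= y)%N) ->
  \sum_(0 <= n < b | P n) (1 : R) <= (b %/ A)%:R + 1.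
Proof.
move=> A0 H; rewrite sum1_countR -size_filter natr1 ler_nat.
set s := [seq n <- _ | _].
have sin x : (x \in s) = (P x && (x < b)%N) by rewrite mem_filter mem_index_iota.
rewrite -(size_map (divn^~ A)) -(size_iota 0 (b %/ A).+1); apply: uniq_leq_size.
  rewrite map_inj_in_uniq ?filter_uniq ?iota_uniq// => x y.
  rewrite !sin => /andP[Px xb] /andP[Py yb] exy.
  have [xy|xy|//] := ltngtP x y.
    by have := leq_div2r A (H _ _ xb yb Px Py xy); rewrite divnDr ?dvdnn// divnn A0 exy addn1 ltnn.
  by have := leq_div2r A (H _ _ yb xb Py Px xy); rewrite divnDr ?dvdnn// divnn A0 exy addn1 ltnn.
move=> _ /mapP[x xs ->]; rewrite mem_iota /= add0n ltnS leq_div2r//.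
by move: xs; rewrite sin => /andP[_ /ltnW].
Qed.

(** Counting by the value of [g], when each value is taken on a set of small
    diameter. *)
Lemma count_fiber a b P (g : nat -> nat) (U : nat) (B : nat -> R) :
  (forall u, 0 <= B u) ->
  (forall x, (a <= x < b)%N -> P x -> (g x <= U)%N) ->
  (forall x y, (a <= x < b)%N -> (a <= y < b)%N -> P x -> P y -> (x <= y)%N ->
     g x = g y -> y%:R - x%:R <= B (g x)) ->
  \sum_(a <= n < b | P n) 1 <= \sum_(0 <= u < U.+1) (B u + 1).
Proof.
move=> B0 gU H.
rewrite big_nat_cond (eq_bigr (fun n => \sum_(0 <= u < U.+1 | u == g n) (1 : R))); last first.
  by move=> n /andP[rn Pn]; rewrite big_nat1_eq ltnS gU.
rewrite (exchange_big_dep_nat xpredT)//=; apply: ler_sum => u _.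
apply: count_diam => // x y rx ry /andP[/andP[_ Px] /eqP ->] /andP[/andP[_ Py] /eqP gxy] xy.
exact: H.
Qed.

(** A point is either at distance at least [A] from the next one, which happens
    for few points, or the first member of a close pair. *)
Lemma count_gaps b P (A : nat) : (0 < A)%N -> (forall x, P x -> (x < b)%N) ->
  \sum_(0 <= n < b | P n) (1 : R) <= (b %/ A)%:R + 1 +
    \sum_(1 <= h < A) \sum_(0 <= n < b | P n && P (n + h)%N) (1 : R).
Proof.
move=> A0 Pb; pose Q n := has (fun h => P (n + h)%N) (index_iota 1 A).
rewrite (bigID Q) /= addrC lerD//.
  apply: count_spaced => // x y xb yb /andP[Px /hasPn nQ] /andP[Py _] xy.
  rewrite leqNgt; apply/negP => yx; have := nQ (y - x)%N.
  rewrite mem_index_iota subn_gt0 xy ltn_subLR ?(ltnW xy)// yx => /(_ isT).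
  by rewrite subnKC ?(ltnW xy)// Py.
rewrite (exchange_big_dep_nat P)//=; last by move=> h n _ _ _ /andP[].
rewrite big_mkcondr; apply: ler_sum => n Pn.
case: ifP => [/hasP[h hA Ph]|_]; last exact: sumr_ge0.
by rewrite Pn /= (big_rem h)//= Ph lerDl; apply: sumr_ge0.
Qed.

End Sums.

(** * Squarefree divisors of an integer *)

Lemma prod_primes_le l : (0 < l)%N -> (\prod_(p <- primes l) p <= l)%N.
Proof.
move=> l0; rewrite [leqRHS](prod_prime_decomp l0) /primes /unzip1 big_map.
rewrite big_seq [leqRHS]big_seq; apply: leq_prod => -[p m] /=.
by case/mem_prime_decomp => pp m0 _; rewrite leq_expl.
Qed.

Lemma prodn_const_seq (I : Type) (s : seq I) (P : pred I) (c : nat) :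
  (\prod_(i <- s | P i) c = c ^ count P s)%N.
Proof. by rewrite big_const_seq iter_muln_1. Qed.

(** Primes above [2 ^ j] satisfy [2 ^ j <= p], and there are at most [2 ^ j]
    smaller ones.  Taking the [j]-th root, the number [2 ^ omega l] of
    squarefree divisors of [l] grows more slowly than any power of [l]. *)
Lemma exp2_omega_le j l : (0 < l)%N ->
  ((2 ^ size (primes l)) ^ j <= 2 ^ (j * 2 ^ j) * l)%N.
Proof.
move=> l0; rewrite -expnM mulnC expnM -count_predT -prodn_const_seq.
rewrite (bigID (fun p => p < 2 ^ j)%N) /=; apply: leq_mul.
  rewrite prodn_const_seq expnM leq_pexp2l ?expn_gt0//.
  rewrite -size_filter -[leqRHS](size_iota 0); apply: uniq_leq_size.
    by rewrite filter_uniq ?primes_uniq.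
  by move=> p; rewrite mem_filter mem_iota => /andP[].
apply: leq_trans (prod_primes_le l0).
rewrite [leqRHS](bigID (fun p => p < 2 ^ j)%N) /=.
apply: (@leq_trans (\prod_(p <- primes l | ~~ (p < 2 ^ j)%N) p)).
  by apply: leq_prod => p; rewrite -leqNgt.
rewrite leq_pmull// big_seq_cond prodn_cond_gt0// => p /andP[].
by rewrite mem_primes => /and3P[/prime_gt0].
Qed.

(** A squarefree divisor of [l] is determined by the set of primes of [l]
    dividing it. *)
Lemma count_sqfree_dvdn l s : (0 < l)%N -> uniq s ->
  (count (fun d => `[< kfree 2 d >] && (d %| l)%N) s <= 2 ^ size (primes l))%N.
Proof.
move=> l0 us; rewrite -size_filter; set t := seq.filter _ _.
pose f (d : nat) := [set i : 'I_(size (primes l)) | (nth 0%N (primes l) i %| d)%N]%SET.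
have <- : #|{set 'I_(size (primes l))}| = (2 ^ size (primes l))%N.
  have := card_powerset [set: 'I_(size (primes l))]%SET.
  by rewrite powersetT !cardsT card_ord.
rewrite -(size_map f).
have ft : uniq (map f t).
  rewrite map_inj_in_uniq ?filter_uniq// => d d'.
  rewrite !mem_filter => /andP[/andP[/asboolP fd dl] _] /andP[/andP[/asboolP fd' dl'] _].
  have sub (a b : nat) : kfree 2 a -> (a %| l)%N -> f a = f b -> (a %| b)%N.
    move=> fa al fab; apply: kfree2_dvdn => // p pp pa.
    have pl : p \in primes l by rewrite mem_primes pp l0 (dvdn_trans pa).
    have ip : (index p (primes l) < size (primes l))%N by rewrite index_mem.
    have : Ordinal ip \in f a by rewrite inE /= nth_index.
    by rewrite fab inE /= nth_index.
  by move=> e; apply/eqP; rewrite eqn_dvd (sub d d')// (sub d' d).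
by rewrite -(card_uniqP ft) max_card.
Qed.

(** * Multiples of a modulus in an interval *)

Lemma sum_multiples_itv (V : nmodType) (q u v : nat) (F : nat -> V) : (0 < q)%N ->
  \sum_(u.+1 <= n < v.+1 | (q %| n)%N) F n =
  \sum_((u %/ q).+1 <= m < (v %/ q).+1) F (q * m)%N.
Proof.
move=> q0; have widen (a b c : nat) (P : pred nat) (G : nat -> V) : (b <= c)%N ->
    \sum_(a <= n < b | P n) G n = \sum_(0 <= n < c | (a <= n)%N && P n && (n < b)%N) G n.
  move=> bc; rewrite (big_nat_widen _ _ _ _ _ bc) (big_nat_widenl _ _ _ _ _ (leq0n a)).
  by apply: eq_bigl => n; rewrite -!andbA; case: (a <= n)%N; rewrite ?andbF ?andbT//= andbC.
rewrite (@widen u.+1 v.+1 v.+1)//.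
rewrite (eq_bigl (fun n => ((u < n) && (n < v.+1)) && (q %| n))%N); last first.
  by move=> n; rewrite -!andbA [((q %| n) && _)%N]andbC.
rewrite sum_multiples// (@widen (u %/ q).+1 (v %/ q).+1 v.+1) ?ltnS ?leq_div//.
apply: eq_bigl => m; rewrite andbT ltn_divLR// !ltnS leq_divRL//.
rewrite [(m * q)%N]mulnC; apply/andP/andP => [[/andP[-> _] //]|[-> h]].
by rewrite h.
Qed.

(** Some multiple of [q] lies in (u, v], expressed by the quotients of its end
    points. *)
Definition has_multiple (u v q : nat) := (u %/ q < v %/ q)%N.

Section Multiples.
Variable R : realType.
Implicit Types (u v q : nat).

Lemma divn_le_real v q : (v %/ q)%:R <= v%:R / q%:R :> R.
Proof.
case: q => [|q]; first by rewrite divn0 invr0 mulr0.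
by rewrite ler_pdivlMr ?ltr0n// -natrM ler_nat leq_divM.
Qed.

Lemma divn_gt_real v q : (0 < q)%N -> v%:R / q%:R < (v %/ q)%:R + 1 :> R.
Proof.
by move=> q0; rewrite ltr_pdivrMr ?ltr0n// natr1 -natrM ltr_nat ltn_ceil.
Qed.

Lemma count_multiplesE u v q : (0 < q)%N ->
  \sum_(u.+1 <= n < v.+1 | (q %| n)%N) (1 : R) = (v %/ q - u %/ q)%:R.
Proof. by move=> q0; rewrite sum_multiples_itv// sumr_const_nat subSS. Qed.

Lemma count_multiples_dist u v q : (0 < q)%N -> (u <= v)%N ->
  `| \sum_(u.+1 <= n < v.+1 | (q %| n)%N) (1 : R) - (v - u)%:R / q%:R | <= 1.
Proof.
move=> q0 uv; rewrite count_multiplesE// natrB ?leq_div2r// natrB// mulrBl.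
have := divn_le_real v q; have := divn_le_real u q.
have := divn_gt_real v q0; have := divn_gt_real u q0.
move=> *; rewrite ler_norml; apply/andP; split; lra.
Qed.

Lemma count_multiples_le1 u v q : (0 < q)%N -> (u <= v)%N -> (v - u <= q)%N ->
  \sum_(u.+1 <= n < v.+1 | (q %| n)%N) (1 : R) <= (has_multiple u v q)%:R.
Proof.
move=> q0 uv H; rewrite count_multiplesE// ler_nat /has_multiple -subn_gt0.
have : (v %/ q <= u %/ q + 1)%N.
  have <- : (q %/ q = 1)%N by rewrite divnn q0.
  by rewrite -divnDr// leq_div2r// -leq_subLR.
by rewrite -leq_subLR; case: (v %/ q - u %/ q)%N => [|[]].
Qed.

End Multiples.

Section MultiplesOfPowers.
Variables (R : realType) (k u v : nat).
Hypotheses (k2 : (2 <= k)%N) (uv : (u <= v)%N).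
Implicit Types (l h b : nat) (W Y : R).
Local Notation good l := (has_multiple u v (l ^ k)).
Local Notation H := ((v - u)%:R : R).
Local Notation V := (v%:R : R).

(** If [l ^ k] has a multiple in (u, v], the cofactor of the largest one falls
    short of [v / l ^ k] by less than [(v - u) / l ^ k]. *)
Lemma quotient_approx l Y : 0 < Y -> Y <= l%:R -> good l ->
  (v %/ l ^ k)%:R <= V / l%:R ^+ k < (v %/ l ^ k)%:R + H / Y ^+ k.
Proof.
move=> Y0 Yl; rewrite /has_multiple => gl.
have l0 : (0 < l)%N by rewrite -(ltr0n R) (lt_le_trans Y0).
have lk0 : (0 < l ^ k)%N by rewrite expn_gt0 l0.
rewrite -natrX divn_le_real /= -ltrBlDl.
apply: (@lt_le_trans _ _ (H / (l ^ k)%:R)).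
  rewrite ltr_pdivlMr ?ltr0n// mulrBl divfK ?pnatr_eq0 -?lt0n// natrB//.
  rewrite ltrD2l ltrN2 -natrM ltr_nat.
  by rewrite mulnC; move: gl; rewrite ltn_divLR// mulnC.
rewrite ler_wpM2l// lef_pV2 ?posrE ?exprn_gt0 ?ltr0n// natrX lerXn2r ?nnegrE ?(ltW Y0)//.
Qed.

(** For a given cofactor [m], two values [x < y] satisfy
    m (y^k - x^k) <= v - u, while y^k - x^k >= (y - x) W^(k-1). *)
Lemma count_has_multiple_ge W (M b : nat) : 0 < W -> V / W ^+ k <= M%:R ->
  \sum_(0 <= l < b | (W <= l%:R) && good l) 1 <=
  \sum_(0 <= m < M.+1) (H / (m%:R * W ^+ k.-1) + 1).
Proof.
move=> W0 VM.
have B0 m : 0 <= H / (m%:R * W ^+ k.-1) by rewrite divr_ge0// mulr_ge0// exprn_ge0// ltW.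
apply: (@count_fiber _ 0%N b _ (fun l => v %/ l ^ k)%N M _ B0).
  move=> x _ /andP[Wx gx]; have /andP[h _] := quotient_approx W0 Wx gx.
  rewrite -(ler_nat R); apply: le_trans VM; apply: le_trans h _.
  have x0 := lt_le_trans W0 Wx.
  rewrite ler_wpM2l// lef_pV2 ?posrE ?exprn_gt0// lerXn2r// nnegrE; exact: ltW.
move=> x y _ _ /andP[Wx gx] /andP[Wy gy] xy exy.
have x0 : (0 < x)%N by rewrite -(ltr0n R) (lt_le_trans W0).
have y0 : (0 < y)%N by rewrite (leq_trans x0).
move: gx gy; rewrite /has_multiple -exy; set m := (v %/ x ^ k)%N => gx gy.
have m0 : (0 < m)%N by case: (m) gx.
rewrite ler_pdivlMr ?mulr_gt0 ?ltr0n ?exprn_gt0//.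
have h1 : (u <= m * x ^ k)%N by rewrite ltnW//; move: gx; rewrite ltn_divLR// expn_gt0 x0.
have h2 : (m * y ^ k <= v)%N by rewrite /m exy leq_divM.
have T := @tangent_pow R k.-1 y%:R x%:R (ler0n _ _) (ler0n _ _).
move: T; rewrite prednK ?(leq_trans _ k2)// => T.
have W1 : (y%:R - x%:R) * W ^+ k.-1 <= y%:R ^+ k - x%:R ^+ k.
  have yx0 : 0 <= y%:R - x%:R :> R by rewrite subr_ge0 ler_nat.
  rewrite lerBrDl; apply: le_trans T; rewrite lerD2l mulrC ler_wpM2r//.
  apply: (@le_trans _ _ (x%:R ^+ k.-1)); first by rewrite lerXn2r ?nnegrE ?(ltW W0).
  by rewrite ler_peMl ?exprn_ge0// ler1n (leq_trans _ k2).
rewrite mulrCA natrB//; apply: (@le_trans _ _ (m%:R * (y%:R ^+ k - x%:R ^+ k))).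
  by rewrite ler_wpM2l.
by rewrite mulrBr -!natrX -!natrM; apply: lerB; rewrite ler_nat.
Qed.

End MultiplesOfPowers.

(** * Two close moduli with multiples in a short interval *)

Lemma eq_ler (R : realType) (x y : R) : x = y -> x <= y.
Proof. by move=> ->. Qed.

Section ClosePairs.
Variable R : realType.
Implicit Types (k : nat) (f : nat -> R).

(** Summing second differences over the rectangle of sides [h] and [j]. *)
Lemma convex_gap f a b (lam : R) :
  (forall x, (a <= x)%N -> (x + 2 <= b)%N -> lam <= f x - 2 * f x.+1 + f x.+2) ->
  forall x j h, (a <= x)%N -> (x + j + h <= b)%N ->
  (h * j)%:R * lam <= f x - f (x + h)%N - (f (x + j)%N - f (x + j + h)%N).
Proof.
move=> Hf.
have step x j : (a <= x)%N -> (x + j + 1 <= b)%N ->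
    j%:R * lam <= f x - f x.+1 - (f (x + j)%N - f (x + j).+1).
  elim: j => [|j IH] ax xb; first by rewrite addn0 subrr mul0r.
  have := IH ax ltac:(lia); have := Hf (x + j)%N ltac:(lia) ltac:(lia).
  rewrite -natr1 mulrDl mul1r -!addnS => *; lra.
move=> x j h ax; elim: h => [|h IH] xb; first by rewrite !addn0 !subrr mul0r.
have := IH ltac:(lia); have := step (x + h)%N j ltac:(lia) ltac:(lia).
rewrite (_ : x + h + j = x + j + h)%N; last lia.
by rewrite mulSn natrD mulrDl !addnS => *; lra.
Qed.

(** The tangent inequality at 1/(x+1) for 1/x and 1/(x+2), the sum of whose
    deviations from 1/(x+1) is 2 / (x (x+1) (x+2)). *)
Lemma invpow_second_diff k x : (0 < k)%N -> (0 < x)%N ->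
  2 * k%:R * x.+2%:R ^- (k + 2) <=
  x%:R ^- k - 2 * x.+1%:R ^- k + x.+2%:R ^- k :> R.
Proof.
case: k => // k _ x0; rewrite -!exprVn.
have X0 : 0 < x%:R :> R by rewrite ltr0n.
set a : R := x%:R^-1; set b : R := x.+1%:R^-1; set c : R := x.+2%:R^-1.
have a0 : 0 < a by rewrite invr_gt0.
have b0 : 0 < b by rewrite invr_gt0 ltr0n.
have c0 : 0 < c by rewrite invr_gt0 ltr0n.
have cb : c <= b by rewrite lef_pV2 ?posrE ?ltr0n// ler_nat.
have ca : c <= a by rewrite lef_pV2 ?posrE// ler_nat; lia.
have T1 := tangent_pow k (ltW a0) (ltW b0).
have T2 := tangent_pow k (ltW c0) (ltW b0).
have E : a + c - 2 * b = 2 * (a * b * c).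
  rewrite /a /b /c -[x.+2%:R]natr1 -[x.+1%:R]natr1; move: (x%:R : R) X0 => z z0.
  by field; rewrite !gt_eqF//; lra.
have [a0' b0' c0'] : [/\ 0 <= a, 0 <= b & 0 <= c] by split; exact: ltW.
have M : c * c * c <= a * b * c by rewrite ler_wpM2r// ler_pM.
have P : c ^+ k <= b ^+ k by rewrite lerXn2r ?nnegrE.
have K0 : 0 <= k.+1%:R :> R by [].
have Q : c ^+ k * (c * c * c) <= b ^+ k * (a * b * c) by rewrite ler_pM ?exprn_ge0 ?mulr_ge0.
have -> : c ^+ (k.+1 + 2) = c ^+ k * (c * c * c) by rewrite addSnnS exprD; congr (_ * _); rewrite !exprS expr0; ring.
have := ler_wpM2l K0 Q; have : k.+1%:R * b ^+ k * (a + c - 2 * b) = 2 * (k.+1%:R * (b ^+ k * (a * b * c))) by rewrite E; ring.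
move=> *; lra.
Qed.

(** Let m(l) be the cofactor at [l].  The difference m(l) - m(l + h) takes few
    values, being of size h k v / Y^(k+1).  If it takes the same value at [x]
    and at [x + j], then the second difference of v / l^k over the rectangle
    of sides [h] and [j] is at most [2 * delta]; convexity bounds [j]. *)
Lemma count_has_multiple_pairs k u v (Y W : R) (h U b : nat) :
  (2 <= k)%N -> (u <= v)%N -> 0 < Y -> 0 <= W -> (0 < h)%N ->
  let good l := (Y <= l%:R) && (l%:R <= W) && has_multiple u v (l ^ k) in
  let delta := (v - u)%:R / Y ^+ k in
  h%:R * k%:R * v%:R / Y ^+ k.+1 + delta <= U%:R ->
  \sum_(0 <= l < b | good l && good (l + h)%N) 1 <=
  U.+1%:R * (delta * W ^+ (k + 2) / (k%:R * v%:R * h%:R) + 1).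
Proof.
move=> k2 uv Y0 W0 h0 good delta HU.
have k0 : (0 < k)%N by lia.
have d0 : 0 <= delta by rewrite divr_ge0// exprn_ge0// ltW.
set B := _ / (_ * h%:R).
have B0 : 0 <= B.
  by apply: divr_ge0; apply: mulr_ge0; first [exact: d0|exact: exprn_ge0|apply: mulr_ge0|idtac].
rewrite (_ : _ * _ = \sum_(0 <= i < U.+1) (B + 1)); last first.
  by rewrite sumr_const_nat subn0 mulr_natl.
pose f l : R := v%:R * l%:R ^- k.
have approx l : good l -> (v %/ l ^ k)%:R <= f l < (v %/ l ^ k)%:R + delta.
  by move=> /andP[/andP[Yl _] gl]; apply: quotient_approx.
have mono l : good l -> (v %/ (l + h) ^ k <= v %/ l ^ k)%N.
  move=> /andP[/andP[Yl _] gl]; apply: leq_div2l.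
    by rewrite expn_gt0 -(ltr0n R) (lt_le_trans Y0).
  by rewrite leq_exp2r// leq_addr.
apply: (@count_fiber _ 0%N b _ (fun l => v %/ l ^ k - v %/ (l + h) ^ k)%N U (fun=> B)) => //.
  move=> x _ /andP[gx gh]; rewrite -(ler_nat R) natrB ?mono//; apply: le_trans HU.
  have /andP[a1 a2] := approx _ gx; have /andP[a3 a4] := approx _ gh.
  have : f x - f (x + h)%N <= h%:R * k%:R * v%:R / Y ^+ k.+1.
    have Yx : Y <= x%:R by case/andP: gx => /andP[].
    have x0 : 0 < x%:R :> R by apply: lt_le_trans Yx.
    have xh0 : 0 < (x + h)%:R :> R by rewrite natrD addr_gt0// ltr0n.
    have T : x%:R ^- k - (x + h)%:R ^- k <= h%:R * k%:R / Y ^+ k.+1.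
      have := @tangent_pow R k.-1 (x + h)%:R^-1 x%:R^-1.
      rewrite prednK// !invr_ge0 !ler0n => /(_ isT isT); rewrite !exprVn => T.
      have E : x%:R^-1 - (x + h)%:R^-1 = h%:R / (x%:R * (x + h)%:R) :> R.
        have -> : h%:R = (x + h)%:R - x%:R :> R by rewrite natrD; ring.
        move: (x + h)%:R (x%:R) xh0 x0 => s t s0 t0.
        by field; rewrite !gt_eqF.
      have : k%:R * x%:R ^- k.-1 * (x%:R^-1 - (x + h)%:R^-1) <= h%:R * k%:R / Y ^+ k.+1.
        rewrite E mulrA -mulrA [h%:R * k%:R]mulrC -!mulrA ler_wpM2l// [leLHS]mulrCA ler_wpM2l//.
        rewrite -invfM lef_pV2 ?posrE ?mulr_gt0 ?exprn_gt0//.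
        apply: (@le_trans _ _ (Y ^+ k.-1 * (Y * Y))).
          by rewrite -[in leLHS](prednK k0) !exprS; apply: eq_ler; ring.
        have Y0' := ltW Y0.
        have Yxh : Y <= (x + h)%:R by rewrite natrD ler_wpDr.
        by rewrite ler_pM ?exprn_ge0 ?mulr_ge0// ?ler_pM// lerXn2r// nnegrE.
      by move=> ?; lra.
    have := ler_wpM2l (ler0n R v) T; rewrite mulrBr -/(f x) -/(f (x + h)%N).
    by move=> /le_trans; apply; apply: eq_ler; ring.
  by move=> ?; lra.
move=> x y _ _ /andP[gx gxh] /andP[gy gyh] xy exy.
have [j ej] : {j | y = (x + j)%N} by exists (y - x)%N; rewrite subnKC.
subst y; rewrite natrD addrC addKr.
have Yx : Y <= x%:R by case/andP: gx => /andP[].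
have x0 : (0 < x)%N by rewrite -(ltr0n R) (lt_le_trans Y0).
have v0 : (0 < v)%N.
  by case/andP: gx => _; rewrite /has_multiple; case: (v) => //; rewrite div0n.
have Wj : (x + j + h)%:R <= W by case/andP: gyh => /andP[].
have wpos : 0 < W by apply: lt_le_trans Wj; rewrite ltr0n !addn_gt0 x0.
have lam x' : (x <= x')%N -> (x' + 2 <= x + j + h)%N ->
    v%:R * (2 * k%:R * W ^- (k + 2)) <= f x' - 2 * f x'.+1 + f x'.+2.
  move=> xx' x'b; have X0 : (0 < x')%N by apply: leq_trans xx'.
  have -> : f x' - 2 * f x'.+1 + f x'.+2 =
    v%:R * (x'%:R ^- k - 2 * x'.+1%:R ^- k + x'.+2%:R ^- k) by rewrite /f; ring.
  rewrite ler_wpM2l//; apply: le_trans (invpow_second_diff k0 X0).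
  rewrite ler_wpM2l ?mulr_ge0// lef_pV2 ?posrE ?exprn_gt0 ?ltr0n// lerXn2r// ?nnegrE//.
  by apply: le_trans Wj; rewrite ler_nat -addn2.
have := convex_gap lam (leqnn _) (leqnn _).
have /andP[a1 a2] := approx _ gx; have /andP[a3 a4] := approx _ gxh.
have /andP[b1 b2] := approx _ gy; have /andP[b3 b4] := approx _ gyh.
have : (v %/ x ^ k)%:R - (v %/ (x + h) ^ k)%:R = (v %/ (x + j) ^ k)%:R - (v %/ (x + j + h) ^ k)%:R :> R.
  by rewrite -!natrB ?mono// exy.
move=> e1 e2; have : (h * j)%:R * (v%:R * (2 * k%:R * W ^- (k + 2))) <= 2 * delta by lra.
rewrite natrM => e3; rewrite /B ler_pdivlMr ?mulr_gt0 ?ltr0n//.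
have W2 : 0 < W ^+ (k + 2) by rewrite exprn_gt0.
rewrite -ler_pdivrMr//; move: (W ^- (k + 2)) e3 => w; lra.
Qed.

End ClosePairs.

(** * Few integers of a short interval have a large k-th power divisor *)

Section CoreCount.
Variable R : realType.
Implicit Types (k b M : nat).

Lemma expR_ge1_nneg (t : R) : 0 <= t -> 1 <= expR t.
Proof. by move=> t0; rewrite -(@expR0 R) ler_expR. Qed.

Lemma ln_natS_diff (m : nat) : (0 < m)%N ->
  (m.+1%:R^-1 : R) <= ln m.+1%:R - ln m%:R <= (m%:R^-1 : R).
Proof.
move=> m0; have M0 : 0 < m%:R :> R by rewrite ltr0n.
have M1 : 0 < m.+1%:R :> R by rewrite ltr0n.
have e : m.+1%:R = m%:R + 1 :> R by rewrite natr1.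
rewrite -ln_div ?posrE//; apply/andP; split.
  rewrite -[X in _ <= X]opprK lerNr -lnV ?posrE ?divr_gt0// invf_div.
  have -> : m%:R / m.+1%:R = 1 + - m.+1%:R^-1 :> R.
    by rewrite e; field; rewrite gt_eqF//; lra.
  by apply: le_ln1Dx; rewrite ltrN2 invf_lt1// ltr1n.
have -> : m.+1%:R / m%:R = 1 + m%:R^-1 :> R by rewrite e; field; rewrite gt_eqF.
by apply: le_ln1Dx; apply: (@lt_trans _ _ 0); rewrite ?ltrN10 ?invr_gt0.
Qed.

Lemma harmonic_le M : (0 < M)%N -> \sum_(1 <= m < M.+1) (m%:R^-1 : R) <= 1 + ln M%:R.
Proof.
elim: M => [//|[|M] IH _]; first by rewrite big_nat1 invr1 ln1 addr0.
rewrite big_nat_recr//=; have /andP[a _] := @ln_natS_diff M.+1 isT.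
apply: le_trans (lerD (IH isT) a) _; apply: eq_ler; ring.
Qed.

Lemma harmonic_ge M : ln M.+1%:R <= \sum_(1 <= m < M.+1) (m%:R^-1 : R).
Proof.
elim: M => [|M IH]; first by rewrite big_geq// ln1.
rewrite big_nat_recr//=; have /andP[_ a] := @ln_natS_diff M.+1 isT.
by apply: le_trans (lerD IH a); apply: eq_ler; ring.
Qed.

Lemma sum1_sub_range b b' (P : pred nat) : (forall x, P x -> (x < b')%N) ->
  \sum_(0 <= l < b | P l) (1 : R) <= \sum_(0 <= l < b' | P l) 1.
Proof.
move=> Pb; rewrite !sum1_countR ler_nat -!size_filter; apply: uniq_leq_size.
  by rewrite filter_uniq ?iota_uniq.
by move=> x; rewrite !mem_filter !mem_index_iota => /andP[Px _]; rewrite Px Pb.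
Qed.

(** The saving over the square root: the interval is allowed to have length
    v^(1/2 - eta).  The value is small enough for the inequalities between
    exponents in [count_has_multiple] and large enough for
    [half_sub_eta_le_delta]. *)
Definition eta k : R := (32 * (k%:R + 1))^-1.

(** Here [expR y] and [expR w] are the end points Y and W of the window, [v]
    and [v - u] are [expR x] and [expR h].  Close pairs are those at distance
    at most W / Y, so that the isolated points number at most about Y.  The last
    two hypotheses say that close pairs number at most a multiple of Y. *)
Lemma count_has_multiple_window k u v (x h y w : R) (b : nat) :
  (2 <= k)%N -> (u < v)%N ->
  x = ln v%:R -> h = ln (v - u)%:R ->
  0 <= y -> h <= k%:R * y -> (k%:R + 1) * y <= x ->
  k%:R * w = x - y ->
  (x - (k%:R + 1) * y) + (w - y) + (h - k%:R * y + (k%:R + 2) * w - x) <= y ->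
  (x - (k%:R + 1) * y) + 2 * (w - y) <= y ->
  \sum_(0 <= l < b | (expR y <= l%:R) && (l%:R <= expR w) && has_multiple u v (l ^ k)) 1
  <= (3 + 6 * k%:R) * expR y.
Proof.
move=> k2 uv xE hE y0 hky kyx kw E1 E2.
set K : R := k%:R in hky kyx kw E1 E2 *.
have K2 : 2 <= K by rewrite ler_nat.
have v0 : (0 < v)%N by apply: leq_trans uv.
have Vx : v%:R = expR x by rewrite xE lnK// posrE ltr0n.
have Hh : (v - u)%:R = expR h by rewrite hE lnK// posrE ltr0n subn_gt0.
have wy : 0 <= w - y by nra.
have P1 : 1 <= expR (x - (K + 1) * y) by apply: expR_ge1_nneg; lra.
set P := expR (x - (K + 1) * y) in P1.
set al := expR (w - y); have al1 : 1 <= al by exact: expR_ge1_nneg.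
have al0 : 0 < al by exact: expR_gt0.
set be := expR (h - K * y + (K + 2) * w - x).
have be0 : 0 < be by exact: expR_gt0.
have Y1 : 1 <= expR y by exact: expR_ge1_nneg.
(* al = W / Y is the largest distance of a close pair, P bounds the size of the
   slope of v / l^k, and be / a the length of a fibre of pairs at distance a. *)
have F1 : P * al * be <= expR y by rewrite -!expRD ler_expR.
have F2 : P * al * al <= expR y.
  by rewrite -!expRD ler_expR; apply: le_trans E2; apply: eq_ler; ring.
pose A := (Num.truncn al).+1.
pose b' := (Num.truncn (expR w)).+1.
pose Q (l : nat) := (expR y <= l%:R) && (l%:R <= expR w) && has_multiple u v (l ^ k).
rewrite -[X in X <= _]/(\sum_(0 <= l < b | Q l) (1 : R)).
have Qb x' : Q x' -> (x' < b')%N.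
  by move=> /andP[/andP[_ +] _]; rewrite /b' ltnS truncn_ge_nat ?expR_ge0.
apply: le_trans (sum1_sub_range b Qb) _.
apply: le_trans (@count_gaps R b' Q A isT Qb) _.
have G1 : (b' %/ A)%:R <= 2 * expR y.
  apply: le_trans (divn_le_real _ _ _) _.
  apply: (@le_trans _ _ ((expR w + 1) / al)).
    rewrite ler_pM// ?invr_ge0 ?ler0n//.
      by rewrite /b' -natr1 lerD2r truncn_le expR_ge0.
    by rewrite lef_pV2 ?posrE ?ltr0n// ltW// truncnS_gt.
  rewrite ler_pdivrMr// (_ : w = y + (w - y)); last by ring.
  rewrite expRD -/al; nra.
have G2 : \sum_(1 <= a < A) \sum_(0 <= n < b' | Q n && Q (n + a)%N) (1 : R) <=
    \sum_(1 <= a < A) (3 * K * P * (be + al)).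
  apply: ler_sum_nat => a /andP[a1 aA].
  have a1R : 1 <= a%:R :> R by rewrite ler1n.
  have aal : a%:R <= al by move: aA; rewrite /A ltnS truncn_ge_nat// ltW.
  pose del : R := (v - u)%:R / expR y ^+ k.
  have delE : del = expR (h - K * y).
    by rewrite /del Hh -expRM_natl -expRN -expRD.
  have del1 : del <= 1 by rewrite delE -(@expR0 R) ler_expR; lra.
  have PE : v%:R / expR y ^+ k.+1 = P.
    by rewrite Vx -expRM_natl -expRN -expRD /P -natr1.
  pose U := (Num.truncn (a%:R * K * P + 1)).+1.
  have := @count_has_multiple_pairs R k u v (expR y) (expR w) a U b' k2 (ltnW uv) (expR_gt0 _) (expR_ge0 _) a1.
  rewrite /= -/Q -/del => /(_ _) T; apply: le_trans (T _) _.
    apply: (@le_trans _ _ (a%:R * K * P + 1)); first by rewrite -mulrA PE lerD.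
    by rewrite ltW// truncnS_gt.
  have aK : 2 <= a%:R * K * P by rewrite -[leLHS]mulr1 ler_pM// -[leLHS]mul1r ler_pM.
  have UP : U.+1%:R <= 3 * (a%:R * K * P).
    have : U%:R <= a%:R * K * P + 1 + 1 by rewrite /U -natr1 lerD2r truncn_le; lra.
    by rewrite -natr1 => ?; lra.
  have BE : del * expR w ^+ (k + 2) / (K * v%:R * a%:R) <= be / a%:R.
    have -> : del * expR w ^+ (k + 2) / (K * v%:R * a%:R) = K^-1 * (be / a%:R).
      have -> : be = del * expR w ^+ (k + 2) / v%:R.
        by rewrite delE Vx -expRM_natl natrD -/K -expRN -!expRD.
      have V0 : 0 < v%:R :> R by rewrite ltr0n.
      by field; rewrite !gt_eqF//; lra.
    apply: ler_piMl; first by rewrite divr_ge0// ltW.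
    by rewrite invf_le1; lra.
  apply: (@le_trans _ _ (3 * (a%:R * K * P) * (be / a%:R + 1))).
    rewrite ler_pM ?lerD//.
    by rewrite addr_ge0// divr_ge0 ?mulr_ge0 ?exprn_ge0 ?expR_ge0// delE expR_ge0.
  rewrite (_ : 3 * _ * _ = 3 * K * P * (be + a%:R)); last by field; rewrite gt_eqF//; lra.
  by rewrite ler_wpM2l ?lerD2l// ?mulr_ge0//; lra.
move: G2; rewrite sumr_const_nat subn1 -mulr_natr => G2.
have : 3 * K * P * (be + al) * A.-1%:R <= 3 * K * P * (be + al) * al.
  apply: ler_wpM2l; last by rewrite truncn_le ltW.
  by rewrite !mulr_ge0//; lra.
rewrite (_ : 3 * K * P * (be + al) * al = 3 * K * (P * al * be + P * al * al)); last by ring.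
move=> G3; have : 3 * K * (P * al * be + P * al * al) <= 3 * K * (expR y + expR y).
  by rewrite ler_wpM2l ?lerD//; lra.
move=> G4; lra.
Qed.

(** Beyond W the cofactors are at most v / W^k <= Y; the sum over them costs a
    logarithm, absorbed by the factor [expR (x / 8)]. *)
Lemma count_has_multiple_beyond k u v (x h y w : R) (b : nat) :
  (2 <= k)%N -> (u < v)%N ->
  x = ln v%:R -> h = ln (v - u)%:R ->
  0 <= y -> y <= x -> x - k%:R * w <= y -> y <= w -> h - k%:R * y + x / 8 <= 0 ->
  \sum_(0 <= l < b | (expR w <= l%:R) && has_multiple u v (l ^ k)) 1
  <= 19 * expR y.
Proof.
move=> k2 uv xE hE y0 yx xkw yw hky.
set K : R := k%:R in xkw hky.
have K2 : 2 <= K by rewrite ler_nat.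
have v0 : (0 < v)%N by apply: leq_trans uv.
have Vx : v%:R = expR x by rewrite xE lnK// posrE ltr0n.
have Hh : (v - u)%:R = expR h by rewrite hE lnK// posrE ltr0n subn_gt0.
have Y1 : 1 <= expR y by exact: expR_ge1_nneg.
pose M := (Num.truncn (expR y)).+1.
have ML : M%:R <= 2 * expR y.
  have : M%:R <= expR y + 1 by rewrite /M -natr1 lerD2r truncn_le expR_ge0.
  by move=> ?; lra.
have := @count_has_multiple_ge R k u v k2 (ltnW uv) (expR w) M b (expR_gt0 _).
move=> /(_ _) T; apply: le_trans (T _) _.
  rewrite Vx -expRM_natl -expRN -expRD; apply: le_trans (ltW (truncnS_gt _)).
  by rewrite ler_expR.
rewrite big_split /= sumr_const_nat subn0 [X in X + _ <= _]big_ltn// mul0r invr0 mulr0 add0r.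
have -> : \sum_(1 <= i < M.+1) ((v - u)%:R / (i%:R * expR w ^+ k.-1)) =
    expR h / expR w ^+ k.-1 * \sum_(1 <= i < M.+1) (i%:R^-1 : R).
  rewrite mulr_sumr; apply: eq_bigr => i _.
  by rewrite Hh invfM mulrA mulrAC.
have lnM : ln M%:R <= 1 + x.
  have : ln M%:R <= ln (2 * expR y) by rewrite ler_ln ?posrE ?ltr0n// mulr_gt0 ?expR_gt0.
  have l2 : ln (2 : R) <= 1 by apply: (@le_ln1Dx R 1); lra.
  by rewrite lnM ?posrE ?expR_gt0// expRK => ?; lra.
have e8 : 2 + x <= 16 * expR (x / 8) by have := expR_ge1Dx (x / 8); lra.
have S1 : \sum_(1 <= i < M.+1) (i%:R^-1 : R) <= 16 * expR (x / 8).
  by apply: le_trans (harmonic_le _) _ => //; lra.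
have S2 : expR h / expR w ^+ k.-1 * expR (x / 8) <= expR y.
  rewrite -expRM_natl -expRN -!expRD ler_expR.
  have -> : k.-1%:R = K - 1 :> R by rewrite /K -subn1 natrB// ltnW.
  nra.
have S3 : 0 <= expR h / expR w ^+ k.-1 by rewrite divr_ge0 ?exprn_ge0 ?expR_ge0.
have S4 := ler_wpM2l S3 S1; rewrite -[M.+1%:R]natr1.
move: (\sum_(_ <= _ < _) _) (expR h / _) S2 S4 ML {S3 S1} => s z S2 S4 ML; lra.
Qed.

Lemma sum1_or3 b (P Q1 Q2 Q3 : pred nat) :
  (forall l, P l -> [|| Q1 l, Q2 l | Q3 l]) ->
  \sum_(0 <= l < b | P l) (1 : R) <= \sum_(0 <= l < b | Q1 l) 1 +
    \sum_(0 <= l < b | Q2 l) 1 + \sum_(0 <= l < b | Q3 l) 1.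
Proof.
move=> PQ; rewrite big_mkcond [X in _ <= X + _ + _]big_mkcond.
rewrite [X in _ <= _ + X + _]big_mkcond [X in _ <= _ + _ + X]big_mkcond -!big_split.
apply: ler_sum => l _ /=; have := PQ l.
case: (P l); case: (Q1 l); case: (Q2 l); case: (Q3 l) => //= H; try lra.
Qed.

(** The window is Y <= l <= W with W^k = v / Y; it is empty when v < Y^(k+1),
    that is, when the interval is longer than about the square root of [v]. *)
Lemma count_has_multiple k u v b :
  (2 <= k)%N -> (u < v)%N ->
  let x : R := ln v%:R in let h : R := ln (v - u)%:R in
  (1 - 2 * eta k) * x <= 2 * h ->
  \sum_(0 <= l < b | has_multiple u v (l ^ k)) 1 <=
    (24 + 6 * k%:R) * expR ((2 * h - eta k * x) / (k%:R + 1)).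
Proof.
move=> k2 uv x h hx; set y := _ / _; set K : R := k%:R in y *.
have K2 : 2 <= K by rewrite ler_nat.
have K1 : 0 < K + 1 by lra.
have v0 : (0 < v)%N by apply: leq_trans uv.
have x0 : 0 <= x by rewrite ln_ge0// ler1n.
have h0 : 0 <= h by rewrite ln_ge0// ler1n subn_gt0.
have hlx : h <= x by rewrite ler_ln ?posrE ?ltr0n ?subn_gt0// ler_nat leq_subr.
pose ex := eta k * x.
have exE : 32 * (K + 1) * ex = x by rewrite /ex /eta -/K; field; rewrite gt_eqF.
have ex0 : 0 <= ex by rewrite mulr_ge0// invr_ge0; lra.
have ex96 : 96 * ex <= x by nra.
have yE : (K + 1) * y = 2 * h - ex by rewrite /y -/ex; field; rewrite gt_eqF.
have hx' : x - 2 * ex <= 2 * h by rewrite /ex; lra.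
have y0 : 0 <= y by nra.
have y3 : 3 * y <= 2 * h - ex by nra.
have yx : y <= x by lra.
have hky : h - K * y + x / 8 <= 0.
  have -> : h - K * y = ex + y - h by lra.
  lra.
have Y1 : 1 <= expR y by exact: expR_ge1_nneg.
have C1 : \sum_(0 <= l < b | l%:R < expR y) (1 : R) <= 2 * expR y.
  apply: (@le_trans _ _ (expR y + 1)); last by lra.
  apply: count_diam; first exact: expR_ge0.
  by move=> a c _ _ _ cY _; apply: le_trans (ltW cY); rewrite gerBl.
have [kyx|xky] := leP ((K + 1) * y) x.
  pose w := (x - y) / K.
  have kw : K * w = x - y by rewrite /w; field; rewrite gt_eqF//; lra.
  have yw : y <= w by nra.
  have C2 := @count_has_multiple_window k u v x h y w b k2 uv erefl erefl y0.
  have C3 := @count_has_multiple_beyond k u v x h y w b k2 uv erefl erefl y0 yx.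
  rewrite -/K in C2 C3.
  have {}C3 := C3 ltac:(lra) yw hky.
  have gK : 2 * (w - y) <= x - (K + 1) * y by nra.
  (* The saving is taken at scale v while y is at scale v^(1/(k+1)): the factor
     32 (k + 1) in eta compensates for this. *)
  have y31 : 31 * ex <= y by rewrite -(ler_pM2l K1); lra.
  have {}C2 := C2 ltac:(lra) kyx kw ltac:(lra) ltac:(lra).
  apply: (le_trans (sum1_or3 _ _)); last by apply: (le_trans (lerD (lerD C1 C2) C3)); lra.
  move=> l /= gl; rewrite gl !andbT; case: ltP => //= _; exact: le_total.
have C3 := @count_has_multiple_beyond k u v x h y y b k2 uv erefl erefl y0 yx.
rewrite -/K in C3; have {}C3 := C3 ltac:(lra) (lexx _) hky.
apply: (le_trans (@sum1_or3 _ _ _ pred0 _ _)); last first.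
  rewrite [X in _ + X + _]big_pred0//; apply: (le_trans (lerD (lerD C1 (lexx 0)) C3)); nra.
by move=> l /= gl; rewrite gl andbT; case: ltP.
Qed.

End CoreCount.

(** * Mean square of the tail of the Moebius sum *)

(** The cofactors of the greatest common divisor of [a] and [b] are coprime,
    and so are their [k]-th powers. *)
Lemma dvdn_lcm_exp k a b n : (0 < a)%N -> (a ^ k %| n)%N -> (b ^ k %| n)%N ->
  (lcmn a b ^ k %| n)%N.
Proof.
move=> a0 an bn; set g := gcdn a b.
have g0 : (0 < g)%N by rewrite gcdn_gt0 a0.
have [a' ea] : {a' | a = g * a'}%N by exists (a %/ g)%N; rewrite mulnC divnK ?dvdn_gcdl.
have [b' eb] : {b' | b = g * b'}%N by exists (b %/ g)%N; rewrite mulnC divnK ?dvdn_gcdr.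
have cop : coprime a' b'.
  by rewrite /coprime -(eqn_pmul2l g0) muln1 muln_gcdr -ea -eb.
have /dvdnP[n' en] : (g ^ k %| n)%N by rewrite (dvdn_trans _ an)// dvdn_exp2r// dvdn_gcdl.
have -> : lcmn a b = (g * (a' * b'))%N.
  by apply/eqP; rewrite -(eqn_pmul2r g0) muln_lcm_gcd {1}ea {1}eb; apply/eqP; lia.
move: an bn; rewrite ea eb en !expnMn ![(g ^ k * _)%N]mulnC !dvdn_pmul2r ?expn_gt0 ?g0//.
by move=> h1 h2; rewrite Gauss_dvd ?h1// coprimeXl// coprimeXr.
Qed.

Section LcmSums.
Variable R : realType.
Implicit Types (k u v N : nat).

Lemma sum_invpow_multiples k N g X : (2 <= k)%N -> (0 < g)%N ->
  \sum_(1 <= d < X | (N < d)%N && (g %| d)%N) (d%:R ^- k : R) <=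
  g%:R ^- k * (2 * ((N %/ g).+1%:R / (N %/ g).+1%:R ^+ k)).
Proof.
move=> k2 g0; rewrite (big_nat_widenl _ 0)//.
rewrite (eq_bigl (fun d => ((N < d) && (1 <= d)) && (g %| d))%N); last first.
  by move=> d; rewrite -!andbA; congr (_ && _); rewrite andbC.
rewrite sum_multiples//.
rewrite (eq_bigr (fun m => g%:R ^- k * m%:R ^- k)); last first.
  by move=> m _; rewrite natrM exprMn invfM.
rewrite -mulr_sumr ler_wpM2l ?invr_ge0 ?exprn_ge0//.
apply: le_trans (sum_invpow_tail R X k2 (ltn0Sn _)).
rewrite [leRHS](big_nat_widenl _ 0)//.
rewrite [leLHS]big_mkcond [leRHS]big_mkcond; apply: ler_sum => m _.
case: ifP => [/andP[/andP[Nm _] _]|_]; last by case: ifP => // _; rewrite invr_ge0 exprn_ge0.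
by rewrite ltn_divLR// mulnC Nm.
Qed.

(** As lcm(a,b)^(-k) = gcd(a,b)^k (a b)^(-k), bounding gcd(a,b)^k by the sum of
    g^k over all common divisors [g] decouples [a] from [b].  The [g <= N] and
    the [g > N] contribute equally; no logarithm is lost. *)
Lemma sum_inv_lcm k N v : (2 <= k)%N ->
  \sum_(1 <= a < v.+1 | (N < a)%N) \sum_(1 <= b < v.+1 | (N < b)%N)
    ((lcmn a b)%:R ^- k : R) <= 12 * (N.+1%:R / N.+1%:R ^+ k).
Proof.
move=> k2.
apply: (@le_trans _ _ (\sum_(1 <= g < v.+1) g%:R ^+ k *
   (\sum_(1 <= d < v.+1 | (N < d)%N && (g %| d)%N) (d%:R ^- k : R)) ^+ 2)).
  rewrite [leRHS](eq_bigr (fun g => \sum_(1 <= a < v.+1 | (N < a)%N) \sum_(1 <= b < v.+1 | (N < b)%N)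
     if (g %| a)%N && (g %| b)%N then g%:R ^+ k * (a%:R ^- k * b%:R ^- k) else 0)); last first.
    move=> g _; rewrite expr2 big_mkcondr big_distrlr mulr_sumr /=.
    apply: eq_bigr => a Na; rewrite mulr_sumr; apply: eq_bigr => b Nb.
    by case: (g %| a)%N; case: (g %| b)%N => //=; rewrite ?(mul0r, mulr0).
  rewrite [leRHS]exchange_big /= [leLHS]big_nat_cond [leRHS]big_nat_cond.
  apply: ler_sum => a /andP[/andP[a0 av] Na].
  rewrite [leRHS]exchange_big /= [leLHS]big_nat_cond [leRHS]big_nat_cond.
  apply: ler_sum => b /andP[/andP[b0 bv] Nb].
  rewrite (big_rem (gcdn a b))/=; last first.
    by rewrite mem_index_iota gcdn_gt0 a0 /= ltnS (leq_trans (dvdn_leq a0 (dvdn_gcdl _ _))).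
  rewrite dvdn_gcdl dvdn_gcdr /=.
  have g0 : 0 < (gcdn a b)%:R :> R by rewrite ltr0n gcdn_gt0 a0.
  rewrite (_ : _ ^- k = (gcdn a b)%:R ^+ k * (a%:R ^- k * b%:R ^- k)); last first.
    rewrite -!exprVn -!exprMn; congr (_ ^+ k).
    have A0 : a%:R != 0 :> R by rewrite pnatr_eq0 -lt0n.
    have B0 : b%:R != 0 :> R by rewrite pnatr_eq0 -lt0n.
    have L0 : (lcmn a b)%:R != 0 :> R by rewrite pnatr_eq0 -lt0n lcmn_gt0 a0.
    rewrite -invfM -natrM -muln_lcm_gcd natrM; field.
    by rewrite L0 gt_eqF.
  rewrite lerDl; apply: sumr_ge0 => g _; case: ifP => // _.
pose m : R := N.+1%:R.
have m0 : 0 < m by rewrite ltr0n.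
(* For g <= N the g-th term is (g / m)^(2k-2) g^(-k), largest at g = m. *)
pose bnd g : R := 4 * (if (g <= N)%N then m ^- k else g%:R ^- k).
apply: (@le_trans _ _ (\sum_(1 <= g < v.+1) bnd g)).
  apply: ler_sum_nat => g /andP[g0 gv].
  have G0 : 0 < g%:R :> R by rewrite ltr0n.
  set B : R := (N %/ g).+1%:R.
  have B0 : 0 < B by rewrite ltr0n.
  have Sle := @sum_invpow_multiples k N g v.+1 k2 g0.
  apply: (@le_trans _ _ (g%:R ^+ k * (g%:R ^- k * (2 * (B / B ^+ k))) ^+ 2)).
    rewrite ler_wpM2l ?exprn_ge0// lerXn2r ?nnegrE//.
      by apply: sumr_ge0 => d _; rewrite invr_ge0 exprn_ge0.
    by rewrite !mulr_ge0 ?invr_ge0 ?exprn_ge0// ltW.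
  have -> : g%:R ^+ k * (g%:R ^- k * (2 * (B / B ^+ k))) ^+ 2 =
      4 * (g%:R ^- k * (B / B ^+ k) ^+ 2).
    by field; rewrite !expf_neq0 ?gt_eqF.
  rewrite /bnd ler_pM2l//; case: leqP => gN; last first.
    rewrite ler_piMr ?invr_ge0 ?exprn_ge0// /B divn_small//.
    by rewrite expr1n divr1 expr1n.
  have mB : m <= g%:R * B by rewrite /m /B -natrM ler_nat mulnC ltn_ceil.
  have gm : g%:R <= m by rewrite ler_nat leqW.
  have E (a b : R) j : a != 0 -> b != 0 ->
      a ^- j.+2 * (b / b ^+ j.+2) ^+ 2 = a ^+ j / ((a * b) ^+ j * (a * b) ^+ j.+2).
    move=> a0 b0; rewrite !exprMn !exprS.
    by field; rewrite a0 b0 !expf_neq0.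
  have ek : k = (k - 2).+2 by lia.
  have -> : g%:R ^- k * (B / B ^+ k) ^+ 2 =
      g%:R ^+ (k - 2) / ((g%:R * B) ^+ (k - 2) * (g%:R * B) ^+ k).
    by rewrite {1 2 5}ek E ?gt_eqF// -ek.
  rewrite ler_pdivrMr ?mulr_gt0 ?exprn_gt0 ?mulr_gt0//.
  rewrite -ler_pdivrMl ?invr_gt0 ?exprn_gt0// invrK mulrC.
  have g0' := ltW G0; have m0' := ltW m0.
  have B0' := ltW B0.
  by rewrite ler_pM ?exprn_ge0// lerXn2r ?nnegrE ?(le_trans gm) ?mulr_ge0.
have bnd_ge0 g : 0 <= bnd g.
  by rewrite mulr_ge0//; case: ifP => _; rewrite invr_ge0 exprn_ge0// ltW.
have -> : 12 * (m / m ^+ k) = 4 * (N%:R * m ^- k) + 4 * (m ^- k) + 4 * (2 * (m / m ^+ k)).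
  by rewrite /m -natr1; field; rewrite expf_neq0// natr1 pnatr_eq0.
apply: (@le_trans _ _ (\sum_(1 <= g < N.+1) bnd g + \sum_(N.+1 <= g < v.+1) bnd g)).
  have [vN|Nv] := leqP v.+1 N.+1.
    rewrite [X in _ <= _ + X]big_geq// addr0 [leRHS](@big_cat_nat _ _ _ v.+1)//=.
    by rewrite lerDl sumr_ge0.
  by rewrite -big_cat_nat//= ltnW.
rewrite lerD//.
  rewrite (eq_big_nat _ _ (F2 := fun=> 4 * m ^- k)); last first.
    by move=> g /andP[_ gN]; rewrite /bnd -ltnS gN.
  rewrite sumr_const_nat subn1 /= -mulr_natr.
  have : 0 <= m ^- k by rewrite invr_ge0 exprn_ge0// ltW.
  move: (m ^- k) => z z0; nra.
rewrite (eq_big_nat _ _ (F2 := fun g => 4 * g%:R ^- k)); last first.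
  by move=> g /andP[gN _]; rewrite /bnd leqNgt gN.
by rewrite -mulr_sumr ler_pM2l// sum_invpow_tail.
Qed.

End LcmSums.

Section TailMoments.
Variable R : realType.
Implicit Types (k u v N l : nat).

Lemma big_mkcond_natr (r : seq nat) (Q : pred nat) :
  \sum_(n <- r) ((Q n)%:R : R) = \sum_(n <- r | Q n) 1.
Proof. by rewrite [RHS]big_mkcond; apply: eq_bigr => n _; case: (Q n). Qed.

Lemma count_multiples_le k u v l : (u < v)%N -> (0 < l)%N ->
  \sum_(u.+1 <= n < v.+1 | (l ^ k %| n)%N) (1 : R) <=
  2 * (v - u)%:R * l%:R ^- k + (has_multiple u v (l ^ k))%:R.
Proof.
move=> uv l0; have q0 : (0 < l ^ k)%N by rewrite expn_gt0 l0.
have L0 : 0 < l%:R ^- k :> R by rewrite invr_gt0 exprn_gt0 ?ltr0n.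
have [small|large] := leqP (v - u) (l ^ k).
  by apply: le_trans (count_multiples_le1 R q0 (ltnW uv) small) _; rewrite lerDr !mulr_ge0// ltW.
have := @count_multiples_dist R u v (l ^ k) q0 (ltnW uv).
rewrite ler_norml natrX => /andP[_].
have : 1 <= (v - u)%:R * l%:R ^- k :> R.
  by rewrite ler_pdivlMr ?exprn_gt0 ?ltr0n// mul1r -natrX ler_nat ltnW.
have : 0 <= (has_multiple u v (l ^ k))%:R :> R by [].
by move=> *; lra.
Qed.

(** The exponent [64 * (k + 1) ^ 2] is chosen so that the square of the right
    hand side is a constant times v^(eta/(k+1)), the power of [v] gained in
    [count_has_multiple]. *)
Lemma omega_weight k v l : (0 < l <= v)%N ->
  ((2 ^ size (primes l))%:R : R) <=
  2 ^+ (2 ^ (64 * (k + 1) ^ 2)) * expR (eta R k * ln v%:R / (k%:R + 1) / 2).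
Proof.
move=> /andP[l0 lv]; set j := (64 * (k + 1) ^ 2)%N.
have j0 : (0 < j)%N by rewrite /j muln_gt0 expn_gt0 addn1.
rewrite -(ler_pXn2r j0) ?nnegrE ?mulr_ge0 ?expR_ge0 ?exprn_ge0//.
rewrite exprMn -expRM_natl (_ : _ * (_ / 2) = ln v%:R); last first.
  rewrite /j natrM natrX natrD /eta; field.
  by rewrite gt_eqF// ltr_wpDl.
rewrite lnK ?posrE ?ltr0n ?(leq_trans l0)// -natrX.
apply: (@le_trans _ _ (2 ^ (j * 2 ^ j) * l)%:R).
  by rewrite -!natrX ler_nat exp2_omega_le.
by rewrite -!natrX -natrM ler_nat leq_mul// -expnM mulnC.
Qed.

(** The constant of [omega_weight], squared, times that of
    [count_has_multiple]. *)
Definition tail_weight k : R := 2 ^+ (2 ^ (64 * (k + 1) ^ 2)) ^+ 2 * (24 + 6 * k%:R).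

Lemma tail_count_le k u v N b : (2 <= k)%N -> (u < v)%N ->
  (1 - 2 * eta R k) * ln v%:R <= 2 * ln (v - u)%:R :> R ->
  \sum_(1 <= d < b | (N < d)%N) \sum_(u.+1 <= n < v.+1 | (d ^ k %| n)%N) (1 : R) <=
    4 * (v - u)%:R * (N.+1%:R / N.+1%:R ^+ k) +
    (24 + 6 * k%:R) * expR (2 * ln (v - u)%:R / (k%:R + 1)).
Proof.
move=> k2 uv hyp.
have v0 : (0 < v)%N by apply: leq_trans uv.
apply: (@le_trans _ _ (\sum_(1 <= d < b | (N < d)%N)
   (2 * (v - u)%:R * d%:R ^- k + (has_multiple u v (d ^ k))%:R))).
  rewrite big_nat_cond [leRHS]big_nat_cond.
  by apply: ler_sum => d /andP[/andP[d0 _] _]; apply: count_multiples_le.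
rewrite big_split /=; apply: lerD.
  rewrite -mulr_sumr -[4]/(2 * 2)%:R natrM -!mulrA ler_pM2l// mulrCA ler_wpM2l//.
  apply: le_trans (sum_invpow_tail R b k2 (ltn0Sn N)).
  rewrite (big_nat_widenl _ 0)// [leRHS](big_nat_widenl _ 0)//.
  rewrite [leLHS]big_mkcond [leRHS]big_mkcond; apply: ler_sum => d _.
  case: (ltnP N d) => //= Nd; first by rewrite (leq_trans _ Nd).
have := @count_has_multiple R k u v b k2 uv hyp.
set E := expR _ => Hc; apply: (@le_trans _ _ ((24 + 6 * k%:R) * E)).
  apply: le_trans Hc; rewrite [leRHS]big_mkcond [leLHS](big_nat_widenl _ 0)// [leLHS]big_mkcond.
  apply: ler_sum => d _; case: ifP => _; last by case: ifP.
  by case: (has_multiple _ _ _).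
rewrite ler_wpM2l ?addr_ge0 ?mulr_ge0// ler_expR ler_pM2r ?invr_gt0 ?ltr_wpDl//.
rewrite gerBl mulr_ge0 ?ln_ge0 ?ler1n// invr_ge0 mulr_ge0// addr_ge0//.
Qed.

(** At most [(2 ^ omega l) ^ 2] pairs of squarefree integers have least common
    multiple [l]. *)
Lemma sum_has_multiple_lcm k u v N : (2 <= k)%N -> (u < v)%N ->
  (1 - 2 * eta R k) * ln v%:R <= 2 * ln (v - u)%:R :> R ->
  \sum_(1 <= a < v.+1 | (N < a)%N && `[< kfree 2 a >])
    \sum_(1 <= b < v.+1 | (N < b)%N && `[< kfree 2 b >])
     ((has_multiple u v (lcmn a b ^ k))%:R : R) <=
  tail_weight k * expR (2 * ln (v - u)%:R / (k%:R + 1)).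
Proof.
move=> k2 uv hyp.
have v0 : (0 < v)%N by apply: leq_trans uv.
pose S l d := `[< kfree 2 d >] && (d %| l)%N.
apply: (@le_trans _ _ (\sum_(1 <= l < v.+1 | has_multiple u v (l ^ k))
   (\sum_(1 <= a < v.+1 | S l a) (1 : R)) * (\sum_(1 <= b < v.+1 | S l b) (1 : R)))).
  rewrite [leRHS](eq_bigr (fun l => \sum_(1 <= a < v.+1) \sum_(1 <= b < v.+1)
      if S l a && S l b then 1 else 0)); last first.
    move=> l _; rewrite [in LHS]big_mkcond big_distrlr /=.
    apply: eq_bigr => a _; rewrite -mulr_sumr.
    case: (S l a) => /=; last by rewrite mul0r big1.
    by rewrite mul1r big_mkcond.
  rewrite [leRHS]exchange_big /= [leLHS]big_nat_cond [leRHS]big_nat_cond.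
  rewrite [leLHS]big_mkcond [leRHS]big_mkcond.
  apply: ler_sum => a _; case: ifP => [/andP[/andP[a0 av] /andP[Na Sa]]|_]; last first.
    case: ifP => // _; apply: sumr_ge0 => l _; apply: sumr_ge0 => b _; by case: ifP.
  rewrite a0 av /= [leRHS]exchange_big /= [leLHS]big_nat_cond [leRHS]big_nat_cond.
  rewrite [leLHS]big_mkcond [leRHS]big_mkcond.
  apply: ler_sum => b _; case: ifP => [/andP[/andP[b0 bv] /andP[Nb Sb]]|_]; last first.
    by case: ifP => // _; apply: sumr_ge0 => l _; case: ifP.
  rewrite b0 bv /=; case: (boolP (has_multiple _ _ _)) => gl /=; last first.
    by apply: sumr_ge0 => l _; case: ifP.
  rewrite (big_rem (lcmn a b)) /=; last first.
    rewrite mem_index_iota lcmn_gt0 a0 b0 /= ltnS leqNgt; apply/negP => vl.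
    move: gl; rewrite /has_multiple (@divn_small v) ?ltn0//.
    by apply: leq_trans vl _; rewrite leq_expl// ltnW.
  rewrite gl /S Sa Sb dvdn_lcml dvdn_lcmr /= lerDl.
  by apply: sumr_ge0 => l _; case: ifP.
rewrite /tail_weight; set C := 2 ^+ _; set E := expR (eta R k * ln v%:R / (k%:R + 1) / 2).
have C0 : 0 <= C by rewrite exprn_ge0.
apply: (@le_trans _ _ (\sum_(0 <= l < v.+1 | has_multiple u v (l ^ k)) (C * E) ^+ 2)).
  rewrite [leLHS](big_nat_widenl _ 0)// [leLHS]big_nat_cond [leRHS]big_nat_cond.
  rewrite [leLHS]big_mkcond [leRHS]big_mkcond.
  apply: ler_sum => l _; case: ifP => [/andP[/andP[_ lv] /andP[gl l0]]|_]; last first.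
    by case: ifP => // _; rewrite sqr_ge0.
  rewrite lv gl /= expr2.
  have cnt : \sum_(1 <= a < v.+1 | S l a) (1 : R) <= C * E.
    rewrite sum1_countR; apply: (@le_trans _ _ (2 ^ size (primes l))%:R).
      by rewrite ler_nat count_sqfree_dvdn ?iota_uniq.
    by apply: omega_weight; rewrite (l0 : (0 < l)%N).
  by rewrite ler_pM// sum1_countR.
have Hc := @count_has_multiple R k u v v.+1 k2 uv hyp.
rewrite (eq_bigr (fun=> (C * E) ^+ 2 * 1)); last by move=> l _; rewrite mulr1.
rewrite -mulr_sumr; apply: le_trans (ler_wpM2l (sqr_ge0 _) Hc) _.
rewrite exprMn [E ^+ 2](_ : _ = expR (eta R k * ln v%:R / (k%:R + 1))); last first.
  by rewrite -expRM_natl; congr expR; field; rewrite gt_eqF// ltr_wpDl.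
apply: eq_ler; rewrite mulrACA; congr (_ * _); rewrite -expRD; congr expR.
by field; rewrite gt_eqF// ltr_wpDl.
Qed.

(** Expanding the square gives a sum over pairs of the number of multiples of
    lcm(a,b)^k; the multiples are counted by [count_multiples_le]. *)
Lemma second_moment k u v N : (2 <= k)%N -> (u < v)%N ->
  (1 - 2 * eta R k) * ln v%:R <= 2 * ln (v - u)%:R :> R ->
  \sum_(u.+1 <= n < v.+1)
     (\sum_(1 <= d < v.+1 | (N < d)%N && (d ^ k %| n)%N) mobius R d) ^+ 2 <=
  24 * (v - u)%:R * (N.+1%:R / N.+1%:R ^+ k) +
  tail_weight k * expR (2 * ln (v - u)%:R / (k%:R + 1)).
Proof.
move=> k2 uv hyp; pose P d := (N < d)%N && `[< kfree 2 d >].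
apply: (@le_trans _ _ (\sum_(1 <= a < v.+1 | P a) \sum_(1 <= b < v.+1 | P b)
   (2 * (v - u)%:R * (lcmn a b)%:R ^- k + (has_multiple u v (lcmn a b ^ k))%:R))); last first.
  rewrite (eq_bigr (fun a => \sum_(1 <= b < v.+1 | P b) (2 * (v - u)%:R * (lcmn a b)%:R ^- k) +
     \sum_(1 <= b < v.+1 | P b) (has_multiple u v (lcmn a b ^ k))%:R)); last first.
    by move=> a _; rewrite big_split.
  rewrite big_split /=; apply: lerD; last exact: sum_has_multiple_lcm.
  rewrite (eq_bigr (fun a => 2 * (v - u)%:R * \sum_(1 <= b < v.+1 | P b) (lcmn a b)%:R ^- k)); last first.
    by move=> a _; rewrite mulr_sumr.
  rewrite -mulr_sumr (_ : 24 * (v - u)%:R = 2 * (v - u)%:R * 12); last by ring.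
  rewrite -[leRHS]mulrA ler_wpM2l ?mulr_ge0//; apply: le_trans (sum_inv_lcm R N v k2).
  have inv0 (a b : nat) : 0 <= (lcmn a b)%:R ^- k :> R by rewrite invr_ge0 exprn_ge0.
  rewrite [leLHS]big_mkcond [leRHS]big_mkcond; apply: ler_sum => a _; rewrite /P.
  case: ifP => [/andP[-> _]|_]; last by case: ifP => // _; apply: sumr_ge0.
  rewrite [leLHS]big_mkcond [leRHS]big_mkcond; apply: ler_sum => b _.
  by case: ifP => [/andP[-> _]//|_]; case: ifP.
apply: (@le_trans _ _ (\sum_(u.+1 <= n < v.+1) \sum_(1 <= a < v.+1 | P a)
   \sum_(1 <= b < v.+1 | P b) ((lcmn a b ^ k %| n)%N)%:R)); last first.
  rewrite exchange_big /= big_nat_cond [leRHS]big_nat_cond.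
  apply: ler_sum => a /andP[/andP[a0 _] _].
  rewrite exchange_big /= big_nat_cond [leRHS]big_nat_cond.
  apply: ler_sum => b /andP[/andP[b0 _] _].
  rewrite big_mkcond_natr.
  by apply: count_multiples_le => //; rewrite lcmn_gt0 a0.
apply: ler_sum => n _.
apply: (@le_trans _ _ ((\sum_(1 <= d < v.+1 | P d && (d ^ k %| n)%N) (1 : R)) ^+ 2)).
  rewrite -real_normK ?num_real// lerXn2r ?nnegrE ?sumr_ge0//.
  apply: le_trans (ler_norm_sum _ _ _) _.
  rewrite [leLHS]big_mkcond [leRHS]big_mkcond; apply: ler_sum => d _; rewrite /P.
  case: (N < d)%N; case: (d ^ k %| n)%N; rewrite ?andbF//= andbT.
  by case: asboolP => fd; [exact: mobius_norm_le1|rewrite /mobius asboolF// normr0].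
clearbody P; rewrite expr2 big_distrlr /= big_mkcondr [leLHS]big_nat_cond [leRHS]big_nat_cond.
apply: ler_sum => a /andP[/andP[a0 _] Pa].
case: ifP => [an|_]; last exact: sumr_ge0.
rewrite big_mkcondr; apply: ler_sum => b Pb; rewrite mulr1.
by case: ifP => [bn|//]; rewrite dvdn_lcm_exp.
Qed.

End TailMoments.

(** * Integration over the unit interval *)

Section UnitIntegral.
Variable R : realType.
Implicit Types (f g : R -> R).

Definition integrable01 f := (@lebesgue_measure R).-integrable `[0, 1]%classic (EFin \o f).
Definition int01 f : R := \int[@lebesgue_measure R]_(x in `[0, 1]%classic) f x.

Lemma integrable01_continuous f : continuous f -> integrable01 f.
Proof.
move=> cf; apply: continuous_compact_integrable; first exact: segment_compact.
exact: continuous_subspaceT.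
Qed.

Lemma lebesgue_01 : lebesgue_measure (`[0, 1]%classic : set R) = 1%:E.
Proof. by rewrite lebesgue_measure_itv /= lte_fin ltr01 oppr0 adde0. Qed.

Lemma integrable01_bounded f M : measurable_fun setT f -> (forall x, `|f x| <= M) -> integrable01 f.
Proof.
move=> mf fM; apply: measurable_bounded_integrable.
- exact: measurable_itv.
- by rewrite [X in (X < _)%E]lebesgue_01 ltry.
- exact: measurable_funTS.
exists M; split; first exact: num_real.
by move=> x Mx y _ /=; apply: le_trans (fM y) (ltW Mx).
Qed.

Lemma integrable01D f g : integrable01 f -> integrable01 g -> integrable01 (fun x => f x + g x).
Proof. by move=> hf hg; rewrite /integrable01; apply: (integrableD _ hf hg). Qed.

Lemma integrable01Z (r : R) f : integrable01 f -> integrable01 (fun x => r * f x).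
Proof. by move=> hf; rewrite /integrable01; apply: (integrableZl _ r hf). Qed.

Lemma integrable01_cst (r : R) : integrable01 (fun=> r).
Proof. by apply: integrable01_continuous => x; apply: cst_continuous. Qed.

Lemma integrable01_sum (I : Type) (s : seq I) (P : pred I) (F : I -> R -> R) :
  (forall i, P i -> integrable01 (F i)) -> integrable01 (fun x => \sum_(i <- s | P i) F i x).
Proof.
move=> hF; elim: s => [|i s IH].
  by rewrite (_ : (fun x => _) = (fun=> 0)) ?integrable01_cst//; apply/funext => x; rewrite big_nil.
rewrite (_ : (fun x => _) = (fun x => if P i then F i x + \sum_(j <- s | P j) F j x
  else \sum_(j <- s | P j) F j x)); last by apply/funext => x; rewrite big_cons.
by case Pi : (P i) => //; apply: integrable01D => //; exact: hF.
Qed.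

Lemma int01D f g : integrable01 f -> integrable01 g -> int01 (fun x => f x + g x) = int01 f + int01 g.
Proof. by move=> hf hg; rewrite /int01 RintegralD. Qed.

Lemma int01Z (r : R) f : integrable01 f -> int01 (fun x => r * f x) = r * int01 f.
Proof. by move=> hf; rewrite /int01 RintegralZl. Qed.

Lemma int01_cst (r : R) : int01 (fun=> r) = r.
Proof. by rewrite /int01 Rintegral_cst// [X in fine X]lebesgue_01 /= mulr1. Qed.

Lemma int01_sum (I : Type) (s : seq I) (P : pred I) (F : I -> R -> R) :
  (forall i, P i -> integrable01 (F i)) ->
  int01 (fun x => \sum_(i <- s | P i) F i x) = \sum_(i <- s | P i) int01 (F i).
Proof.
move=> hF; elim: s => [|i s IH].
  by rewrite big_nil (_ : (fun x => _) = (fun=> 0)) ?int01_cst//; apply/funext => x; rewrite big_nil.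
rewrite (_ : (fun x => _) = (fun x => if P i then F i x + \sum_(j <- s | P j) F j x
  else \sum_(j <- s | P j) F j x)); last by apply/funext => x; rewrite big_cons.
rewrite big_cons; case Pi : (P i) => //.
by rewrite int01D ?IH//; [exact: hF|exact: integrable01_sum].
Qed.

Lemma le_int01 f g : integrable01 f -> integrable01 g -> (forall x, 0 <= x <= 1 -> f x <= g x) ->
  int01 f <= int01 g.
Proof.
by move=> hf hg fg; apply: le_Rintegral => // x; rewrite /= in_itv; exact: fg.
Qed.

Definition itv_ind (a b x : R) : R := ((a <= x <= b)%R)%:R.

Lemma itv_indE a b : itv_ind a b = \1_(`[a, b]%classic).
Proof. by apply/funext => x; rewrite /itv_ind indicE mem_setE in_itv. Qed.

Lemma integrable01_ind a b : integrable01 (itv_ind a b).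
Proof.
apply: (@integrable01_bounded _ 1); last by move=> x; rewrite /itv_ind; case: (_ <= _ <= _); rewrite ?normr1 ?normr0.
by rewrite itv_indE; exact: measurable_indic.
Qed.

Lemma int01_itv_ind_measure a b : int01 (itv_ind a b) =
  fine (lebesgue_measure (`[a, b]%classic `&` `[0, 1]%classic : set R)%classic).
Proof. by rewrite /int01 itv_indE /Rintegral integral_indic. Qed.

Lemma int01_itv_ind_le a b : a <= b -> int01 (itv_ind a b) <= b - a.
Proof.
move=> ab; rewrite int01_itv_ind_measure.
have mab : lebesgue_measure (`[a, b]%classic : set R) = (b - a)%:E.
  rewrite lebesgue_measure_itv /= lte_fin; case: ltP => // ba.
  by rewrite (@le_anti _ _ a b) ?ab ?subrr.
set A : set R := (`[a, b]%classic `&` `[0, 1]%classic)%classic.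
have le : (lebesgue_measure A <= (b - a)%:E)%E.
  rewrite -mab; apply: le_measure; rewrite ?inE.
  - by apply: measurableI; exact: measurable_itv.
  - exact: measurable_itv.
  - by move=> x [].
rewrite -lee_fin fineK// fin_numE; apply/andP; split.
  by rewrite gt_eqF// (lt_le_trans _ (measure_ge0 _ _)).
by rewrite lt_eqF// (le_lt_trans le) ?ltry.
Qed.

Lemma int01_itv_ind a b : 0 <= a -> a <= b -> b <= 1 -> int01 (itv_ind a b) = b - a.
Proof.
move=> a0 ab b1; rewrite int01_itv_ind_measure setIidl; last first.
  move=> x; rewrite /= !in_itv /= => /andP[ax xb].
  by rewrite (le_trans a0 ax) (le_trans xb b1).
rewrite lebesgue_measure_itv /= lte_fin; case: ltP => // ba.
by rewrite (@le_anti _ _ a b) ?ab ?subrr.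
Qed.

Lemma sin_2pi_nat n : sin (2 * pi * n%:R) = 0 :> R.
Proof.
elim: n => [|n IH]; first by rewrite mulr0 sin0.
rewrite -[n.+1%:R]natr1 mulrDr mulr1 sinD IH mul0r add0r mulr_natl sin2pi mulr0//.
Qed.

Lemma cos_2pi_nat n : cos (2 * pi * n%:R) = 1 :> R.
Proof.
elim: n => [|n IH]; first by rewrite mulr0 cos0.
by rewrite -[n.+1%:R]natr1 mulrDr mulr1 cosD IH mul1r sin_2pi_nat mul0r subr0 mulr_natl cos2pi.
Qed.

Lemma int01_cos n : (0 < n)%N -> int01 (fun x => cos (2 * pi * (n%:R * x))) = 0.
Proof.
move=> n0; pose w : R := 2 * pi * n%:R.
have w0 : w != 0 by rewrite !mulf_neq0 ?pnatr_eq0 -?lt0n// gt_eqF// pi_gt0.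
pose F (x : R) := w^-1 * sin (w * x).
have dF (x : R) : is_derive x (1 : R) F (cos (w * x)).
  have d1 : is_derive x (1 : R) (fun y : R => w * y) w.
    by have := @is_deriveZ _ _ _ (@id R) w x 1 1 (is_derive_id _ _); rewrite [w *: 1]mulr1.
  have d2 := @is_derive1_comp _ sin (fun y : R => w * y) x _ _ (is_derive_sin _) d1.
  have := @is_deriveZ _ _ _ _ w^-1 x 1 _ d2.
  by rewrite [_ *: _](_ : _ = cos (w * x)) // /GRing.scale /= mulrCA mulVf// mulr1.
have cF : continuous F by move=> x; apply/differentiable_continuous/derivable1_diffP; case: (dF x).
have cc : continuous (fun x : R => cos (w * x)).
  move=> x; apply: (@continuous_comp _ _ _ (fun x => w * x) cos); last exact: continuous_cos.
  exact: mulrl_continuous.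
rewrite (_ : (fun x => _) = (fun x => cos (w * x))); last first.
  by apply/funext => x; rewrite /w mulrA.
rewrite /int01 /Rintegral (@continuous_FTC2 _ _ F)//.
- by rewrite /F /w mulr1 mulr0 sin_2pi_nat sin0 mulr0 subee.
- exact: continuous_subspaceT.
- split.
  + by move=> x _; case: (dF x).
  + by apply: cvg_at_right_filter; apply: cF.
  + by apply: cvg_at_left_filter; apply: cF.
- by move=> x _; rewrite derive1E; case: (dF x).
Qed.

End UnitIntegral.

(** * Trigonometric polynomials and Parseval *)

Section TrigPoly.
Variable R : realType.
Implicit Types (a b x al : R) (c : nat -> R) (u v : nat).

Lemma eD a b : e (a + b) = e a * e b.
Proof.
by rewrite /e mulrDr cosD sinD; apply/eqP; rewrite eq_complex /= eqxx addrC eqxx.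
Qed.

Lemma e_nat n : e (n%:R : R) = 1.
Proof. by rewrite /e sin_2pi_nat cos_2pi_nat. Qed.

Lemma cmod_ge0 (z : R[i]) : 0 <= cmod z.
Proof. by case: z => x y; rewrite /cmod /= sqrtr_ge0. Qed.

Lemma cmodD (z w : R[i]) : cmod (z + w) <= cmod z + cmod w.
Proof. exact: le_normcD. Qed.

Lemma cmodM (z w : R[i]) : cmod (z * w) = cmod z * cmod w.
Proof. exact: ComplexField.Normc.normcM. Qed.

Lemma cmodN (z : R[i]) : cmod (- z) = cmod z.
Proof. exact: normcN. Qed.

Lemma cmod_real x : cmod (x%:C)%C = `|x|.
Proof. by rewrite /cmod /= expr0n /= addr0 sqrtr_sqr. Qed.

Lemma cmod_e a : cmod (e a) = 1.
Proof. by rewrite /cmod /e /= cos2Dsin2 sqrtr1. Qed.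

Lemma cmod_sum (I : Type) (s : seq I) (P : pred I) (F : I -> R[i]) :
  cmod (\sum_(i <- s | P i) F i) <= \sum_(i <- s | P i) cmod (F i).
Proof.
elim/big_rec2: _ => [|i y z _ h]; first by rewrite (cmod_real 0) normr0.
by apply: le_trans (cmodD _ _) _; rewrite lerD2l.
Qed.

Definition trigpoly c u v al : R[i] :=
  \sum_(u.+1 <= n < v.+1) (c n)%:C%C * e (n%:R * al).

Lemma trigpolyE c u v al : trigpoly c u v al =
  ((\sum_(u.+1 <= n < v.+1) c n * cos (2 * pi * (n%:R * al))) +i*
   (\sum_(u.+1 <= n < v.+1) c n * sin (2 * pi * (n%:R * al))))%C.
Proof.
rewrite /trigpoly; elim: (index_iota _ _) => [|n s IH]; first by rewrite !big_nil.
rewrite !big_cons IH; apply/eqP; rewrite eq_complex /= !mul0r subr0 addr0 !eqxx.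
by [].
Qed.

Lemma cmod_trigpoly_le c u v al : cmod (trigpoly c u v al) <= \sum_(u.+1 <= n < v.+1) `|c n|.
Proof.
apply: le_trans (cmod_sum _ _ _) _; apply: ler_sum => n _.
by rewrite cmodM cmod_e mulr1 cmod_real.
Qed.

Lemma trigpolyD c c' u v al :
  trigpoly (fun n => c n + c' n) u v al = trigpoly c u v al + trigpoly c' u v al.
Proof.
rewrite /trigpoly -big_split; apply: eq_bigr => n _ /=.
by rewrite -mulrDl; congr (_ * _); apply/eqP; rewrite eq_complex /= addr0 !eqxx.
Qed.

Lemma continuous_sum_seq (s : seq nat) (F : nat -> R -> R) :
  (forall n, continuous (F n)) -> continuous (fun x => \sum_(n <- s) F n x).
Proof.
move=> cF; elim: s => [|n s IH].
  by rewrite (_ : (fun x => _) = (fun=> 0)); [move=> x; exact: cst_continuous|apply/funext => x; rewrite big_nil].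
rewrite (_ : (fun x => _) = (fun x => F n x + \sum_(m <- s) F m x)); last first.
  by apply/funext => x; rewrite big_cons.
by move=> x; apply: cvgD; [exact: cF|exact: IH].
Qed.

Lemma continuous_wave (f : R -> R) (k w : R) : continuous f ->
  continuous (fun x => k * f (2 * pi * (w * x))).
Proof.
move=> cf x; apply: cvgM; first exact: cst_continuous.
apply: (@continuous_comp _ _ _ (fun x => 2 * pi * (w * x)) f); last exact: cf.
rewrite (_ : (fun x => _) = (fun x => 2 * pi * w * x)); last by apply/funext => y; rewrite mulrA.
exact: mulrl_continuous.
Qed.

Lemma continuous_cmod_trigpoly c u v : continuous (fun x => cmod (trigpoly c u v x)).
Proof.
rewrite (_ : (fun x => _) = (fun x => Num.sqrt (
   (\sum_(u.+1 <= n < v.+1) c n * cos (2 * pi * (n%:R * x))) ^+ 2 +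
   (\sum_(u.+1 <= n < v.+1) c n * sin (2 * pi * (n%:R * x))) ^+ 2))); last first.
  by apply/funext => x; rewrite trigpolyE.
have cc := @continuous_sum_seq (index_iota u.+1 v.+1) _ (fun n => @continuous_wave _ (c n) n%:R (@continuous_cos R)).
have cs := @continuous_sum_seq (index_iota u.+1 v.+1) _ (fun n => @continuous_wave _ (c n) n%:R (@continuous_sin R)).
move=> x; apply: continuous_comp; last exact: sqrt_continuous.
by apply: cvgD; [apply: cvgM; exact: cc|apply: cvgM; exact: cs].
Qed.

Lemma integrable01_cmod c u v : integrable01 (fun x => cmod (trigpoly c u v x)).
Proof. exact/integrable01_continuous/continuous_cmod_trigpoly. Qed.

Lemma integrable01_cmod_sqr c u v : integrable01 (fun x => cmod (trigpoly c u v x) ^+ 2).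
Proof.
by apply: integrable01_continuous => x; apply: cvgM; exact: continuous_cmod_trigpoly.
Qed.

Lemma integrable01_cmod_powR c u v p : 0 <= p -> integrable01 (fun x => cmod (trigpoly c u v x) `^ p).
Proof.
move=> p0; apply: (@integrable01_bounded _ _ ((\sum_(u.+1 <= n < v.+1) `|c n|) `^ p)).
  apply: (measurableT_comp (measurable_powR p)).
  by apply: continuous_measurable_fun; exact: continuous_cmod_trigpoly.
move=> x; rewrite ger0_norm ?powR_ge0//; apply: ge0_ler_powR => //; rewrite ?nnegrE ?cmod_ge0//.
  by apply: sumr_ge0.
exact: cmod_trigpoly_le.
Qed.

(** The product of the terms of indices [n] and [m] contributes a cosine of
    frequency |n - m|, here written with truncated subtractions. *)
Lemma parseval c u v : int01 (fun x => cmod (trigpoly c u v x) ^+ 2) =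
  \sum_(u.+1 <= n < v.+1) c n ^+ 2.
Proof.
rewrite (_ : (fun x => _) = (fun x => \sum_(u.+1 <= n < v.+1) \sum_(u.+1 <= m < v.+1)
   (c n * c m) * cos (2 * pi * ((n - m + (m - n))%N%:R * x)))); last first.
  apply/funext => x; rewrite trigpolyE /cmod /= sqr_sqrtr ?addr_ge0 ?sqr_ge0//.
  rewrite !expr2 !big_distrlr -big_split /=; apply: eq_bigr => n _.
  rewrite -big_split /=; apply: eq_bigr => m _.
  rewrite (_ : cos (_ * ((_ + _)%N%:R * x)) = cos (2 * pi * (n%:R * x) - 2 * pi * (m%:R * x))).
    by rewrite cosB; ring.
  have [mn|nm] := leqP m n.
    by rewrite (eqP (_ : m - n == 0)%N) ?subn_eq0// addn0 natrB//; congr cos; ring.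
  rewrite (eqP (_ : n - m == 0)%N) ?subn_eq0 1?ltnW// add0n natrB 1?ltnW//.
  by rewrite -cosN; congr cos; ring.
have ic (n m : nat) : integrable01 (fun x : R => (c n * c m) * cos (2 * pi * ((n - m + (m - n))%N%:R * x))).
  by apply: integrable01_continuous; exact/continuous_wave/continuous_cos.
rewrite int01_sum; last by move=> n _; apply: integrable01_sum.
rewrite big_seq [RHS]big_seq; apply: eq_bigr => n nin.
rewrite int01_sum// (big_rem n)//= big1_seq ?addr0.
  rewrite (_ : (fun x => _) = (fun=> c n ^+ 2)) ?int01_cst//.
  by apply/funext => x; rewrite subnn addn0 mul0r mulr0 cos0 mulr1.
move=> m /andP[_]; rewrite mem_rem_uniq ?iota_uniq// inE => /andP[mn _].
rewrite (@int01Z _ (c n * c m) (fun x => cos (2 * pi * ((n - m + (m - n))%N%:R * x)))) ?int01_cos ?mulr0//.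
  by rewrite addn_gt0 !subn_gt0; case: ltngtP mn.
have := @continuous_wave cos 1 (n - m + (m - n))%N%:R (@continuous_cos R).
by move=> /integrable01_continuous; congr integrable01; apply/funext => x; rewrite mul1r.
Qed.

End TrigPoly.

(** * Geometric sums *)

Section Geometric.
Variable R : realType.
Implicit Types (x y t s : R) (q u v a b n : nat).

Lemma sin_le_id y : 0 <= y -> sin y <= y.
Proof.
rewrite le_eqVlt => /predU1P[<-|y0]; first by rewrite sin0.
have [c _] := @MVT R sin cos 0 y y0 (fun z _ => is_derive_sin z) (continuous_subspaceT (@continuous_sin R)).
by rewrite sin0 !subr0 => ->; rewrite ler_piMl ?(ltW y0)// cos_le1.
Qed.

(** Twice the sine of half the angle, squared, is 1 - cos. *)
Lemma cos_ge_quadratic y : 0 <= y -> 1 - y ^+ 2 / 2 <= cos y.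
Proof.
move=> y0; have h0 : 0 <= y / 2 by rewrite divr_ge0.
have -> : cos y = 1 - 2 * sin (y / 2) ^+ 2.
  by rewrite {1}(splitr y) cosD -!expr2 cos2sin2; ring.
have := sin_le_id h0; have := @sin_max R (y / 2).
have [s0|s0] := leP 0 (sin (y / 2)); first by move=> _ h; nra.
rewrite ler_norml => /andP[h _] _.
have [|y2] := leP (sin (y / 2) ^+ 2) ((y / 2) ^+ 2); first by move=> ?; lra.
exfalso; have y1 : 1 <= y / 2 \/ y / 2 <= 1 by case: (leP 1 (y / 2)); [left|move=> /ltW; right].
case: y1 => y1; first by nra.
have : 0 <= sin (y / 2) by apply: sin_ge0_pi; rewrite h0 /=; have := pi_ge2 R; lra.
by move=> ?; lra.
Qed.

Lemma sin_ge_half y : 0 <= y <= 1 -> y / 2 <= sin y.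
Proof.
move=> /andP[]; rewrite le_eqVlt => /predU1P[<- _|y0 y1]; first by rewrite sin0 mul0r.
have [c] := @MVT R sin cos 0 y y0 (fun z _ => is_derive_sin z) (continuous_subspaceT (@continuous_sin R)).
rewrite in_itv /= => /andP[c0 cy]; rewrite sin0 !subr0 => ->.
have := cos_ge_quadratic (ltW c0); nra.
Qed.

(** For 2 pi s <= 1 this follows from the linear lower bound for the sine; for
    larger arguments the cosine decreases further, and the left side is at most
    1/4. *)
Lemma chord_ge s : 0 <= s <= 1 / 2 -> s ^+ 2 <= 2 - 2 * cos (2 * pi * s).
Proof.
move=> /andP[s0 s2]; have p2 := pi_ge2 R.
have sq (z : R) : sin z ^+ 2 <= 2 - 2 * cos z.
  by have := sqr_ge0 (1 - cos z); rewrite sin2cos2; nra.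
have [y1|y1] := leP (2 * pi * s) 1.
  have y0 : 0 <= 2 * pi * s by rewrite !mulr_ge0 ?pi_ge0.
  have := sq (2 * pi * s); have := @sin_ge_half (2 * pi * s); rewrite y0 y1 => /(_ isT).
  have : s <= pi * s by rewrite ler_peMl//; lra.
  have -> : 2 * pi * s / 2 = pi * s by field.
  move=> a b; have ss := le_trans a b; apply: le_trans.
  by rewrite lerXn2r// nnegrE (le_trans s0 ss).
have c1 : cos (2 * pi * s) <= cos 1.
  rewrite ltW// ltr_cos ?in_itv//= ?ler01/=; nra.
have := sq 1; have := @sin_ge_half 1; rewrite ler01 lexx => /(_ isT) => ? ?.
have : sin (1 : R) ^+ 2 >= 1 / 4 by nra.
nra.
Qed.

Lemma cmod_1e_sqr t : cmod (1 - e t) ^+ 2 = 2 - 2 * cos (2 * pi * t).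
Proof.
rewrite /cmod /e /= sqr_sqrtr ?addr_ge0 ?sqr_ge0// sub0r sqrrN sin2cos2; ring.
Qed.

Lemma cmod_1e_ge t : `|t| <= 1 / 2 -> `|t| <= cmod (1 - e t).
Proof.
move=> t2; rewrite -(@ler_pXn2r _ 2) ?nnegrE ?cmod_ge0// cmod_1e_sqr.
have <- : cos (2 * pi * `|t|) = cos (2 * pi * t).
  by have [|] := ger0P t => // _; rewrite mulrN cosN.
by apply: chord_ge; rewrite normr_ge0.
Qed.

Definition geom (a b : nat) x : R[i] := \sum_(a <= m < b) e (m%:R * x).

Lemma geom_telescope a b x : (a <= b)%N ->
  (1 - e x) * geom a b x = e (a%:R * x) - e (b%:R * x).
Proof.
move=> ab; rewrite /geom mulr_sumr.
rewrite (eq_bigr (fun m => - e (m.+1%:R * x) - (- e (m%:R * x)))); last first.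
  by move=> m _; rewrite -[m.+1%:R]natr1 [(m%:R + 1) * x]mulrDl mul1r eD; ring.
by rewrite (telescope_sumr (fun m : nat => - e (m%:R * x)))// opprK addrC.
Qed.

Lemma cmod_geom_le_size a b x : cmod (geom a b x) <= (b - a)%:R.
Proof.
apply: le_trans (cmod_sum _ _ _) _.
rewrite (eq_bigr (fun=> 1)); last by move=> m _; rewrite cmod_e.
by rewrite sumr_const_nat.
Qed.

Lemma cmod_geom_mul a b n t : (a <= b)%N -> `|t| <= 1 / 2 ->
  `|t| * cmod (geom a b (n%:R + t)) <= 2.
Proof.
move=> ab t2; have ex : e (n%:R + t) = e t by rewrite eD e_nat mul1r.
have := congr1 (@cmod R) (geom_telescope (n%:R + t) ab).
rewrite cmodM ex => E; apply: (@le_trans _ _ (cmod (1 - e t) * cmod (geom a b (n%:R + t)))).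
  by rewrite ler_wpM2r ?cmod_ge0// cmod_1e_ge.
by rewrite E; apply: le_trans (cmodD _ _) _; rewrite cmodN !cmod_e.
Qed.

End Geometric.

(** * Mean modulus of a progression *)

Section ProgressionL1.
Variable R : realType.
Implicit Types (x y t al : R) (q u v n J : nat).

Definition progression q u v al : R[i] := trigpoly (fun n => ((q %| n)%N)%:R : R) u v al.

Lemma progressionE q u v al : (0 < q)%N ->
  progression q u v al = geom (u %/ q).+1 (v %/ q).+1 (q%:R * al).
Proof.
move=> q0; rewrite /progression /trigpoly /geom.
rewrite (eq_bigr (fun n => if (q %| n)%N then e (n%:R * al) else 0)); last first.
  by move=> n _; case: ifP => _; rewrite ?mul1r ?mul0r.
rewrite -big_mkcond sum_multiples_itv//; apply: eq_bigr => m _.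
by rewrite natrM mulrA [q%:R * m%:R]mulrC.
Qed.

(** A step function version of y <= min(2^J, 2/|t|), whose integral needs only
    the lengths of intervals. *)
Lemma dyadic_bound t y J : `|t| <= 1 / 2 -> 0 <= y -> `|t| * y <= 2 -> y <= 2 ^+ J ->
  y <= \sum_(0 <= j < J.+1) 4 * 2 ^+ j * (`|t| <= 2 ^- j)%R%:R.
Proof.
move=> t2 y0 ty yJ.
have pos j : 0 <= 4 * 2 ^+ j * (`|t| <= 2 ^- j)%R%:R :> R by rewrite !mulr_ge0// exprn_ge0.
have claim i : 2 ^- i < `|t| -> y <= \sum_(0 <= j < i) 4 * 2 ^+ j * (`|t| <= 2 ^- j)%R%:R.
  elim: i => [|i IH] ti.
    by exfalso; move: ti; rewrite expr0 invr1 => ?; lra.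
  (* Either the induction hypothesis applies or the new scale alone suffices. *)
  rewrite big_nat_recr//=; have [tle|tgt] := leP `|t| (2 ^- i); last first.
    by rewrite mulr0 addr0; exact: IH.
  rewrite mulr1; apply: (@le_trans _ _ (4 * 2 ^+ i)); last by rewrite lerDr sumr_ge0.
  have w0 : 0 < 2 ^+ i :> R by rewrite exprn_gt0.
  have zw : (2 ^+ i)^-1 * 2 ^+ i = 1 :> R by rewrite mulVf// gt_eqF.
  move: ti; rewrite exprS invfM mulrC => ti; have h := ler_wpM2r y0 (ltW ti).
  have zy : (2 ^+ i)^-1 * y <= 4 by lra.
  by have := ler_wpM2r (ltW w0) zy; rewrite mulrAC zw mul1r.
have [tle|tgt] := leP `|t| (2 ^- J); last first.
  by apply: le_trans (claim _ tgt) _; rewrite big_nat_recr//= lerDl.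
rewrite big_nat_recr//= tle mulr1; apply: le_trans yJ _.
rewrite -[leLHS]add0r lerD ?sumr_ge0// ler_peMl ?exprn_ge0//; lra.
Qed.

(** The bound of [dyadic_bound] at the distance from [q * al] to the nearest
    integer [n], enlarged by summing over all [n <= q]. *)
Lemma progression_pointwise q u v al J : (0 < q)%N -> (u <= v)%N -> 0 <= al <= 1 ->
  (v - u)%:R <= 2 ^+ J :> R ->
  cmod (progression q u v al) <=
  \sum_(0 <= j < J.+1) \sum_(0 <= n < q.+1)
     4 * 2 ^+ j * itv_ind ((n%:R - 2 ^- j) / q%:R) ((n%:R + 2 ^- j) / q%:R) al.
Proof.
move=> q0 uv /andP[al0 al1] HJ; have Q0 : 0 < q%:R :> R by rewrite ltr0n.
rewrite progressionE//; set A := (u %/ q).+1; set B := (v %/ q).+1.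
have AB : (A <= B)%N by rewrite ltnS leq_div2r.
have z0 : 0 <= q%:R * al + 1 / 2 by rewrite addr_ge0 ?mulr_ge0 ?divr_ge0.
pose n := Num.truncn (q%:R * al + 1 / 2).
have /andP[n1 n2] : n%:R <= q%:R * al + 1 / 2 < n.+1%:R by rewrite truncn_itv.
clearbody n; rewrite -[n.+1%:R]natr1 in n2.
pose t := q%:R * al - n%:R.
have t2 : `|t| <= 1 / 2.
  by rewrite ler_norml /t; apply/andP; split; lra.
have nq : (n < q.+1)%N.
  rewrite -(ltr_nat R); apply: le_lt_trans n1 _; rewrite -[q.+1%:R]natr1.
  have : q%:R * al <= q%:R by rewrite ler_piMr// ltW.
  by move=> ?; lra.
have E : q%:R * al = n%:R + t by rewrite /t; ring.
rewrite E.
have y0 := cmod_ge0 (geom A B (n%:R + t)).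
have ty := cmod_geom_mul n AB t2.
have yJ : cmod (geom A B (n%:R + t)) <= 2 ^+ J.
  apply: le_trans (cmod_geom_le_size _ _ _) _; apply: le_trans HJ.
  rewrite ler_nat subSS leq_subLR addnC -divnMDl// leq_div2r//.
  by rewrite addnC -leq_subLR leq_pmulr.
apply: le_trans (dyadic_bound t2 y0 ty yJ) _.
apply: ler_sum => j _; rewrite -mulr_sumr ler_wpM2l ?mulr_ge0 ?exprn_ge0//.
rewrite (big_rem n) ?mem_index_iota//=.
case: (leP `|t| _) => [tj|_]; last first.
  by rewrite addr_ge0 ?sumr_ge0//.
apply: ler_wpDr; first exact: sumr_ge0.
rewrite /itv_ind ler_pdivrMr// ler_pdivlMr// mulrC E.
move: tj; rewrite ler_norml => /andP[h1 h2].
rewrite (_ : (_ && _)); last by apply/andP; split; lra.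
done.
Qed.

Lemma exists_pow2 (x : R) : 1 <= x ->
  exists2 J : nat, x <= 2 ^+ J & J%:R <= 2 * ln x + 1.
Proof.
move=> x1; have l0 := ln_ge0 x1; have x0 : 0 < x by lra.
exists (Num.truncn (2 * ln x)).+1; last first.
  by rewrite -natr1 lerD2r truncn_le mulr_ge0.
set J := (Num.truncn _).+1.
have Jl : 2 * ln x <= J%:R by rewrite ltW// truncnS_gt.
have e2 : expR (1 / 2) <= 2 :> R.
  have := @expR_ge1Dx R (- (1 / 2)); rewrite expRN => h.
  have E0 := @expR_gt0 R (1 / 2).
  have : (1 / 2) * expR (1 / 2) <= 1 :> R.
    have := ler_wpM2r (ltW E0) h; rewrite mulVf ?gt_eqF//; lra.
  by move=> ?; lra.
apply: (@le_trans _ _ (expR (J%:R * (1 / 2)))).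
  by rewrite -[leLHS]lnK ?posrE// ler_expR; lra.
by rewrite expRM_natl lerXn2r ?nnegrE ?expR_ge0.
Qed.

(** The intervals at scale [2 ^- j] have total length about [2 ^- j], so each of
    the O(log H) scales contributes O(1), uniformly in [q]. *)
Lemma int01_progression q u v : (0 < q)%N -> (u < v)%N ->
  int01 (fun al => cmod (progression q u v al)) <= 32 * (1 + ln (v - u)%:R).
Proof.
move=> q0 uv; have H1 : 1 <= (v - u)%:R :> R by rewrite ler1n subn_gt0.
have [J HJ Jle] := exists_pow2 H1.
have Q0 : 0 < q%:R :> R by rewrite ltr0n.
pose w j n : R -> R := itv_ind ((n%:R - 2 ^- j) / q%:R) ((n%:R + 2 ^- j) / q%:R).
have iw j n : integrable01 (fun al => 4 * 2 ^+ j * w j n al) by apply: integrable01Z; exact: integrable01_ind.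
apply: (@le_trans _ _ (int01 (fun al => \sum_(0 <= j < J.+1) \sum_(0 <= n < q.+1)
   4 * 2 ^+ j * w j n al))).
  apply: le_int01.
  - exact: integrable01_cmod.
  - by apply: integrable01_sum => j _; apply: integrable01_sum.
  - by move=> al hal; apply: progression_pointwise => //; exact: ltnW.
rewrite int01_sum; last by move=> j _; apply: integrable01_sum.
apply: (@le_trans _ _ (\sum_(0 <= j < J.+1) (16 : R))); last first.
  rewrite sumr_const_nat subn0 -[16 *+ _]mulr_natr -[J.+1%:R]natr1; lra.
apply: ler_sum => j _; rewrite int01_sum//.
have W0 : 0 < 2 ^+ j :> R by rewrite exprn_gt0.
apply: (@le_trans _ _ (\sum_(0 <= n < q.+1) (8 / q%:R))).
  apply: ler_sum => n _; rewrite int01Z; last exact: integrable01_ind.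
  apply: (@le_trans _ _ (4 * 2 ^+ j * (2 * 2 ^- j / q%:R))).
    rewrite ler_wpM2l ?mulr_ge0 ?exprn_ge0//; apply: le_trans (int01_itv_ind_le _) _.
      rewrite ler_pM2r ?invr_gt0//; have : 0 < 2 ^- j :> R by rewrite invr_gt0.
      by move=> ?; lra.
    by apply: eq_ler; field; rewrite !gt_eqF.
  by apply: eq_ler; field; rewrite !gt_eqF.
rewrite sumr_const_nat subn0 -[_ *+ q.+1]mulr_natr -[q.+1%:R]natr1.
have q1 : 1 <= q%:R :> R by rewrite ler1n.
have -> : 8 / q%:R * (q%:R + 1) = 8 + 8 / q%:R :> R by field; rewrite gt_eqF.
have : 8 / q%:R <= 8 :> R by rewrite ler_pdivrMr// ler_peMr.
by move=> ?; lra.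
Qed.

End ProgressionL1.

(** * Upper bound for the moment *)

Section UpperBound.
Variable R : realType.
Implicit Types (k u v N : nat) (al : R).

Definition mobius_low k v N n : R := \sum_(1 <= d < v.+1 | (d <= N)%N && (d ^ k %| n)%N) mobius R d.
Definition mobius_high k v N n : R := \sum_(1 <= d < v.+1 | (N < d)%N && (d ^ k %| n)%N) mobius R d.

Lemma trigpoly_mu_split k u v N al : (0 < k)%N ->
  trigpoly (mu_k R k) u v al =
  trigpoly (mobius_low k v N) u v al + trigpoly (mobius_high k v N) u v al.
Proof.
move=> k0; rewrite -trigpolyD; apply: eq_big_nat => n /andP[un nv].
rewrite (@mu_k_sum R k n v)//; last by rewrite (leq_ltn_trans _ un).
rewrite (bigID (fun d => d <= N)%N) /=; congr ((_ + _)%:C%C * _).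
  by apply: eq_bigl => d; rewrite andbC.
by apply: eq_bigl => d; rewrite -ltnNge andbC.
Qed.

Lemma trigpoly_low k u v N al :
  trigpoly (mobius_low k v N) u v al =
  \sum_(1 <= d < v.+1 | (d <= N)%N) (mobius R d)%:C%C * progression (d ^ k) u v al.
Proof.
rewrite /progression /trigpoly.
rewrite (eq_bigr (fun n => \sum_(1 <= d < v.+1 | (d <= N)%N)
  (mobius R d)%:C%C * (((d ^ k %| n)%N)%:R%:C%C * e (n%:R * al)))); last first.
  move=> n _; rewrite /mobius_low big_mkcondr rmorph_sum mulr_suml.
  by apply: eq_bigr => d _; case: ifP => _; rewrite ?mul1r// !mul0r mulr0.
by rewrite exchange_big /=; apply: eq_bigr => d _; rewrite mulr_sumr.
Qed.

Lemma int01_low k u v N : (u < v)%N ->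
  int01 (fun al => cmod (trigpoly (mobius_low k v N) u v al)) <=
  N%:R * (32 * (1 + ln (v - u)%:R)).
Proof.
move=> uv; have H1 : 1 <= (v - u)%:R :> R by rewrite ler1n subn_gt0.
have l0 := ln_ge0 H1.
apply: (@le_trans _ _ (int01 (fun al => \sum_(1 <= d < v.+1 | (d <= N)%N)
   cmod (progression (d ^ k) u v al)))).
  apply: le_int01; [exact: integrable01_cmod|by apply: integrable01_sum => d _; exact: integrable01_cmod|].
  move=> al _; rewrite trigpoly_low; apply: le_trans (cmod_sum _ _ _) _.
  apply: ler_sum => d _; rewrite cmodM cmod_real.
  by rewrite ler_piMl ?cmod_ge0// mobius_norm_le1.
rewrite int01_sum; last by move=> d _; exact: integrable01_cmod.
apply: (@le_trans _ _ (\sum_(1 <= d < v.+1 | (d <= N)%N) (32 * (1 + ln (v - u)%:R)))).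
  rewrite big_nat_cond [leRHS]big_nat_cond; apply: ler_sum => d /andP[/andP[d0 _] _].
  by apply: int01_progression => //; rewrite expn_gt0 d0.
rewrite big_const_seq iter_addr_0 -[_ *+ count _ _]mulr_natl ler_wpM2r//.
  by rewrite mulr_ge0//; lra.
rewrite ler_nat -size_filter -[leqRHS](size_iota 1); apply: uniq_leq_size.
  by rewrite filter_uniq ?iota_uniq.
by move=> d; rewrite mem_filter mem_index_iota mem_iota => /andP[dN /andP[-> _]]; rewrite add1n ltnS.
Qed.

(** Chebyshev's inequality in pointwise form.  If [lam < x <= 2 * lam], then
    [a >= lam / 2] or [b > lam / 2], so one of the two quotients is at
    least 1. *)
Lemma powR_layer (x p lam0 : R) (a b : nat -> R) (J : nat) :
  0 <= x -> 0 <= p <= 2 -> 0 < lam0 -> x <= 2 ^+ J * lam0 ->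
  (forall j, 0 <= a j /\ 0 <= b j) -> (forall j, x <= a j + b j) ->
  x `^ p <= lam0 `^ p + \sum_(0 <= j < J) 4 * (2 ^+ j * lam0) `^ p *
    (2 * a j / (2 ^+ j * lam0) + 4 * b j ^+ 2 / (2 ^+ j * lam0) ^+ 2).
Proof.
move=> x0 /andP[p0 p2] l0 xJ ab0 xab.
have lam_gt0 j : 0 < 2 ^+ j * lam0 by rewrite mulr_gt0 ?exprn_gt0.
pose F j := 4 * (2 ^+ j * lam0) `^ p *
    (2 * a j / (2 ^+ j * lam0) + 4 * b j ^+ 2 / (2 ^+ j * lam0) ^+ 2).
have F0 j : 0 <= F j.
  have [a0 b0] := ab0 j; have := ltW (lam_gt0 j) => lj.
  by rewrite /F mulr_ge0 ?mulr_ge0 ?powR_ge0// addr_ge0// divr_ge0 ?exprn_ge0// mulr_ge0// exprn_ge0.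
have S0 i : 0 <= \sum_(0 <= j < i) F j by apply: sumr_ge0.
elim: J xJ => [|J IH] xJ.
  rewrite big_geq// addr0; apply: ge0_ler_powR; rewrite ?nnegrE ?(ltW l0)//.
  by rewrite expr0 mul1r in xJ.
rewrite big_nat_recr//= addrA; have [xle|xgt] := leP x (2 ^+ J * lam0).
  by apply: le_trans (IH xle) _; rewrite lerDl; exact: F0.
set lam := 2 ^+ J * lam0 in xgt *; have lj : 0 < lam by exact: lam_gt0.
have [a0 b0] := ab0 J; have xl := xab J.
have one : 1 <= 2 * a J / lam + 4 * b J ^+ 2 / lam ^+ 2.
  have [al|al] := leP (lam / 2) (a J).
    have h1 : 1 <= 2 * a J / lam by rewrite ler_pdivlMr//; lra.
    have : 0 <= 4 * b J ^+ 2 / lam ^+ 2 by rewrite divr_ge0 ?mulr_ge0 ?exprn_ge0// ltW.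
    by move=> ?; lra.
  have h1 : 1 <= 4 * b J ^+ 2 / lam ^+ 2 by rewrite ler_pdivlMr ?exprn_gt0//; nra.
  have : 0 <= 2 * a J / lam by rewrite divr_ge0 ?mulr_ge0// ltW.
  by move=> ?; lra.
have h4 : x `^ p <= 4 * lam `^ p.
  apply: (@le_trans _ _ ((2 * lam) `^ p)).
    have xJ' : x <= 2 * lam by rewrite /lam mulrA -exprS.
    by apply: ge0_ler_powR => //; rewrite nnegrE mulr_ge0// ltW.
  rewrite powRM ?(ltW lj)// ler_wpM2r ?powR_ge0//.
  by apply: (@le_trans _ _ (2 `^ 2%:R)); [rewrite ler_powR ?ler1n|rewrite powR_mulrn// -natrX ler_nat].
rewrite -[leLHS]add0r; apply: lerD; first by apply: addr_ge0; [exact: powR_ge0|exact: S0].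
by apply: le_trans h4 _; rewrite ler_peMr// mulr_ge0// powR_ge0.
Qed.

(** With D^k = H / (lam L) and L = 1 + log H, the two parts at level [lam] give
    lam^(1/k) D L and lam^(1/k - 1) H D^(1-k), both equal to
    E = H^(1/k) L^(1 - 1/k).  Exponents are handled through logarithms. *)
Lemma moment_upper k u v : (2 <= k)%N -> (u < v)%N ->
  (1 - 2 * eta R k) * ln v%:R <= 2 * ln (v - u)%:R :> R ->
  int01 (fun al => cmod (trigpoly (mu_k R k) u v al) `^ (1 + k%:R^-1)) <=
  (1 + 2 * (640 + 16 * tail_weight R k)) *
  expR (ln (v - u)%:R / k%:R + (2 - k%:R^-1) * ln (1 + ln (v - u)%:R)).
Proof.
move=> k2 uv hyp; set h : R := ln (v - u)%:R.
set K : R := k%:R; have K2 : 2 <= K by rewrite ler_nat.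
have H1 : 1 <= (v - u)%:R :> R by rewrite ler1n subn_gt0.
have h0 : 0 <= h by exact: ln_ge0.
have HE : (v - u)%:R = expR h by rewrite lnK// posrE; apply: lt_le_trans H1.
have KV0 : 0 < K^-1 by rewrite invr_gt0; lra.
have KV1 : K^-1 <= 1 / 2 by rewrite -[1 / 2]/(1 * 2^-1) mul1r lef_pV2 ?posrE//; lra.
set p : R := 1 + K^-1.
set l := ln (1 + h).
have l0 : 0 <= l by apply: ln_ge0; lra.
have lE : expR l = 1 + h by rewrite lnK// posrE; lra.
set E := expR (h / K + (1 - K^-1) * l).
have E0 : 0 < E by exact: expR_gt0.
set M := tail_weight R k.
have M0 : 0 <= M by rewrite mulr_ge0 ?exprn_ge0// addr_ge0 ?mulr_ge0.
have SM n := second_moment n k2 uv hyp.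
rewrite -/M -/h -/K in SM; clearbody M.
have [J HJ Jle] := exists_pow2 H1; rewrite -/h in Jle.
pose s j : R := j%:R * ln 2 + h / (K + 1).
pose lam0 := expR (h / (K + 1)).
have K1 : 0 < K + 1 by lra.
have hK1 : 0 <= h / (K + 1) by rewrite divr_ge0 ?(ltW K1).
have lam0_ge1 : 1 <= lam0 by exact: expR_ge1_nneg.
have ln2_0 : 0 <= ln 2 :> R by apply: ln_ge0; rewrite ler1n.
have sE j : 2 ^+ j * lam0 = expR (s j).
  by rewrite /s expRD expRM_natl lnK// posrE.
have s_ge j : h / (K + 1) <= s j by rewrite /s lerDr mulr_ge0.
(* The j-th level is 2^j lam0 = expR (s j), with cut N j = H^(1/k)/(lam L)^(1/k). *)
pose N j := Num.truncn (expR ((h - s j - l) / K)).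
pose a j al := cmod (trigpoly (mobius_low k v (N j)) u v al).
pose b j al := cmod (trigpoly (mobius_high k v (N j)) u v al).
pose A j := 4 * expR (s j * p) * (2 / expR (s j)).
pose B j := 4 * expR (s j * p) * (4 / expR (s j) ^+ 2).
have itA j : integrable01 (fun al => A j * a j al) by apply: integrable01Z; exact: integrable01_cmod.
have itB j : integrable01 (fun al => B j * b j al ^+ 2) by apply: integrable01Z; exact: integrable01_cmod_sqr.
have layer al : cmod (trigpoly (mu_k R k) u v al) `^ p <=
    expR (h / K) + \sum_(0 <= j < J) (A j * a j al + B j * b j al ^+ 2).
  have xJ : cmod (trigpoly (mu_k R k) u v al) <= 2 ^+ J * lam0.
    apply: le_trans (cmod_trigpoly_le _ _ _ _) _.
    apply: (@le_trans _ _ (\sum_(u.+1 <= n < v.+1) (1 : R))).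
      by apply: ler_sum => n _; rewrite /mu_k; case: asboolP; rewrite /= ?normr1 ?normr0.
    rewrite sumr_const_nat subSS; apply: le_trans HJ _.
    by rewrite ler_peMr// exprn_ge0.
  have hp : 0 <= p <= 2 by rewrite /p; apply/andP; split; lra.
  have ab0 j : 0 <= a j al /\ 0 <= b j al by split; exact: cmod_ge0.
  have ab j : cmod (trigpoly (mu_k R k) u v al) <= a j al + b j al.
    by rewrite (trigpoly_mu_split u v (N j)) ?cmodD// ltnW.
  have Lay := powR_layer (cmod_ge0 _) hp (expR_gt0 _) xJ ab0 ab.
  apply: le_trans Lay _; apply: lerD.
    by apply: eq_ler; rewrite -expRM; congr expR; rewrite /p; field; rewrite !gt_eqF//; lra.
  apply: ler_sum => j _; apply: eq_ler.
  by rewrite sE -expRM /A /B; ring.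
have termA j : A j * int01 (a j) <= 256 * E.
  have A0 : 0 <= A j by rewrite /A !mulr_ge0 ?invr_ge0 ?expR_ge0.
  apply: le_trans (ler_wpM2l A0 (int01_low k (N j) uv)) _; rewrite -/h -lE.
  have NE : (N j)%:R <= expR ((h - s j - l) / K) by rewrite truncn_le expR_ge0.
  apply: (@le_trans _ _ (A j * (expR ((h - s j - l) / K) * (32 * expR l)))).
    by rewrite ler_wpM2l// ler_wpM2r// mulr_ge0 ?expR_ge0.
  apply: eq_ler; rewrite /A -expRN.
  have -> : E = expR (s j * p) * expR (- s j) * expR ((h - s j - l) / K) * expR l.
    by rewrite -!expRD /E; congr expR; rewrite /p; field; rewrite gt_eqF//; lra.
  by ring.
have termB j : B j * int01 (fun al => b j al ^+ 2) <= (384 + 16 * M) * E.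
  have B0 : 0 <= B j by rewrite /B !mulr_ge0 ?invr_ge0 ?exprn_ge0 ?expR_ge0.
  rewrite parseval; apply: le_trans (ler_wpM2l B0 (SM (N j))) _.
  rewrite [leLHS]mulrDr [leRHS]mulrDl; apply: lerD.
    set m : R := (N j).+1%:R.
    have m0 : 0 < m by rewrite ltr0n.
    have Dm : expR ((h - s j - l) / K) <= m by rewrite ltW// truncnS_gt.
    have k1 : k.-1.+1 = k by rewrite prednK// ltnW.
    have mk : m / m ^+ k <= expR ((1 - K) * ((h - s j - l) / K)).
      have -> : m / m ^+ k = m ^- k.-1.
        by rewrite -{1}k1 exprS; field; rewrite expf_neq0 gt_eqF.
      have -> : (1 - K) * ((h - s j - l) / K) = - (k.-1%:R * ((h - s j - l) / K)).
        by rewrite -[K]/(k%:R) -{1}k1 -[k.-1.+1%:R]natr1; ring.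
      rewrite expRN expRM_natl lef_pV2 ?posrE ?exprn_gt0 ?expR_gt0//.
      by rewrite lerXn2r ?nnegrE ?expR_ge0// ltW.
    apply: (@le_trans _ _ (B j * (24 * expR h * expR ((1 - K) * ((h - s j - l) / K))))).
      by rewrite ler_wpM2l// HE ler_wpM2l// mulr_ge0 ?expR_ge0.
    apply: eq_ler; rewrite /B -expRM_natl -expRN.
    have -> : E = expR (s j * p) * expR (- (2 * s j)) * expR h * expR ((1 - K) * ((h - s j - l) / K)).
      by rewrite -!expRD /E; congr expR; rewrite /p; field; rewrite gt_eqF//; lra.
    by ring.
  (* This is where lam >= H^(1/(k+1)) is used. *)
  have e1 : expR (s j * p) * expR (- (2 * s j)) * expR (2 * h / (K + 1)) <= E.
    rewrite -!expRD ler_expR.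
    have sj := ler_wpM2r (_ : 0 <= 1 - K^-1) (s_ge j).
    have q0 : 0 <= 1 - K^-1 by lra.
    have := sj q0; have := mulr_ge0 q0 l0.
    have -> : s j * p + - (2 * s j) + 2 * h / (K + 1) =
      2 * (h / (K + 1)) - s j * (1 - K^-1) by rewrite /p; field; rewrite !gt_eqF//; lra.
    have <- : 2 * (h / (K + 1)) - h / (K + 1) * (1 - K^-1) = h / K.
      by field; rewrite !gt_eqF//; lra.
    by move=> ? ?; lra.
  rewrite /B -expRM_natl -expRN.
  have := ler_wpM2l M0 e1.
  move: (expR (s j * p)) (expR (- _)) (expR (2 * h / _)) => x1 x2 x3 Hx.
  by rewrite [X in X <= _](_ : _ = 16 * (M * (x1 * x2 * x3))); [lra|ring].
have itS : integrable01 (fun al => \sum_(0 <= j < J) (A j * a j al + B j * b j al ^+ 2)).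
  by apply: integrable01_sum => j _; apply: integrable01D.
apply: (@le_trans _ _ (int01 (fun al => expR (h / K) +
  \sum_(0 <= j < J) (A j * a j al + B j * b j al ^+ 2)))).
  apply: le_int01 => [||al _]; last exact: layer.
    by apply: integrable01_cmod_powR; rewrite /p; lra.
  by apply: integrable01D => //; exact: integrable01_cst.
rewrite int01D//; last exact: integrable01_cst.
rewrite int01_cst int01_sum; last by move=> j _; apply: integrable01D.
have sumE : \sum_(0 <= j < J) int01 (fun al => A j * a j al + B j * b j al ^+ 2) <=
    J%:R * ((640 + 16 * M) * E).
  apply: (@le_trans _ _ (\sum_(0 <= j < J) ((640 + 16 * M) * E))).
    apply: ler_sum => j _; rewrite int01D// !int01Z; [|exact: integrable01_cmod_sqr|exact: integrable01_cmod].
    by have := termA j; have := termB j => ? ?; lra.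
  by rewrite sumr_const_nat subn0 -[_ *+ J]mulr_natl.
set T := expR (_ + _ * _).
have TE : T = expR l * E.
  by rewrite /T /E -expRD; congr expR; rewrite /K; ring.
have hT : expR (h / K) <= T.
  by rewrite ler_expR lerDl mulr_ge0//; lra.
have JL : J%:R <= 2 * expR l by rewrite lE; lra.
have W0 : 0 <= (640 + 16 * M) * E.
  by apply: mulr_ge0 (ltW E0); apply: addr_ge0 (mulr_ge0 _ M0); exact: ler0n.
have := ler_wpM2r W0 JL.
move=> h1; apply: (le_trans (lerD hT (le_trans sumE h1))).
by apply: eq_ler; rewrite TE; ring.
Qed.

End UpperBound.

(** * Density of k-free integers *)

Section LowerTools.
Variable R : realType.
Implicit Types (k u v n d r a X : nat).

(** Any integer that is not k-free is a multiple of d^k for some [d >= 2]; such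
    multiples carry at most the fraction 3/4 of the weight. *)
Lemma kfree_weighted k X (w : nat -> R) (W : R) : (2 <= k)%N -> (forall n, 0 <= w n) ->
  W = \sum_(1 <= n < X.+1) w n ->
  (forall q, (0 < q)%N -> \sum_(1 <= n < X.+1 | (q %| n)%N) w n <= W / q%:R) ->
  W / 4 <= \sum_(1 <= n < X.+1 | `[< kfree k n >]) w n.
Proof.
move=> k2 w0 WE Wq.
have W0 : 0 <= W by rewrite WE sumr_ge0.
have bad : \sum_(1 <= n < X.+1 | ~~ `[< kfree k n >]) w n <= 3 / 4 * W.
  apply: (@le_trans _ _ (\sum_(2 <= d < X.+1) \sum_(1 <= n < X.+1 | (d ^ k %| n)%N) w n)).
    rewrite (exchange_big_dep_nat xpredT)//= [leLHS]big_nat_cond [leRHS]big_nat_cond.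
    rewrite [leLHS]big_mkcond [leRHS]big_mkcond; apply: ler_sum => n _.
    rewrite andbT; case: ifP => [/andP[rn nf]|_]; last by case: ifP => // _; apply: sumr_ge0.
    rewrite rn; move: rn nf => /andP[n0 nX] /asboolPn/existsNP[p /not_implyP[pp /negP]]; rewrite negbK => pn.
    rewrite (big_rem p)/= ?pn ?lerDl ?sumr_ge0// mem_index_iota prime_gt1//=.
    apply: leq_ltn_trans nX; apply: leq_trans (dvdn_leq n0 pn).
    by rewrite leq_expl// ltnW.
  apply: (@le_trans _ _ (\sum_(2 <= d < X.+1) (d%:R ^- k * W))).
    apply: ler_sum_nat => d /andP[d2 _]; apply: le_trans (Wq _ _) _.
      by rewrite expn_gt0 ltnW.
    by rewrite natrX mulrC.
  by rewrite -mulr_suml ler_wpM2r// sum_invpow_ge2.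
have : W = \sum_(1 <= n < X.+1 | `[< kfree k n >]) w n + \sum_(1 <= n < X.+1 | ~~ `[< kfree k n >]) w n.
  by rewrite WE (bigID (fun n => `[< kfree k n >])).
by move=> ?; lra.
Qed.

Lemma count_kfree k X : (2 <= k)%N ->
  X%:R / 4 <= \sum_(1 <= n < X.+1 | `[< kfree k n >]) (1 : R).
Proof.
move=> k2; apply: kfree_weighted => //; first by rewrite sumr_const_nat subn1.
move=> q q0; rewrite (@count_multiplesE R 0 X q q0) div0n subn0.
exact: divn_le_real.
Qed.

Lemma sum_inv_sqfree X :
  ln X.+1%:R / 4 <= \sum_(1 <= r < X.+1 | `[< kfree 2 r >]) (r%:R^-1 : R).
Proof.
apply: (@le_trans _ _ ((\sum_(1 <= r < X.+1) (r%:R^-1 : R)) / 4)).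
  by rewrite ler_pM2r ?harmonic_ge// invr_gt0.
apply: kfree_weighted => // q q0.
rewrite (@sum_multiples_itv _ q 0 X (fun n => n%:R^-1 : R) q0) div0n.
rewrite (eq_bigr (fun m => m%:R^-1 * q%:R^-1)); last by move=> m _; rewrite natrM invfM mulrC.
rewrite -mulr_suml ler_wpM2r ?invr_ge0//.
rewrite [leRHS](@big_cat_nat _ _ _ (X %/ q).+1)//= ?ltnS ?leq_div//.
by rewrite lerDl sumr_ge0// => m _; rewrite invr_ge0.
Qed.

Lemma sum_at_most_one (s : seq nat) (P : pred nat) (F : nat -> R) (B : R) :
  uniq s -> 0 <= B -> (forall i, i \in s -> P i -> F i <= B) ->
  (forall i j, i \in s -> j \in s -> P i -> P j -> F i != 0 -> F j != 0 -> i = j) ->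
  \sum_(i <- s | P i) F i <= B.
Proof.
move=> us B0 FB one.
have [all0|/allPn[i si /norP[/negPn Pi Fi]]] := boolP (all (fun i => ~~ P i || (F i == 0)) s).
  rewrite big_seq_cond big1// => i /andP[si Pi].
  by have := allP all0 _ si; rewrite Pi /= => /eqP.
rewrite (big_rem i)//= Pi big_seq_cond big1 ?addr0 ?FB// => j.
rewrite mem_rem_uniq// inE => /andP[/andP[ji sj] Pj].
by apply/eqP; apply: contraT => Fj; move: ji; rewrite (one i j)// eqxx.
Qed.

Lemma cmod_e_sub_le (x y : R) : cmod (e x - e y) <= 8 * `|x - y|.
Proof.
have ex : e x = e y * e (x - y) by rewrite -eD addrC subrK.
have -> : e x - e y = - e y * (1 - e (x - y)) by rewrite {1}ex; ring.
rewrite cmodM cmodN cmod_e mul1r; set t := x - y.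
rewrite -(@ler_pXn2r _ 2) ?nnegrE ?cmod_ge0 ?mulr_ge0// cmod_1e_sqr.
have -> : cos (2 * pi * t) = cos (2 * pi * `|t|).
  by have [|] := ger0P t => // _; rewrite mulrN cosN.
have t0 := normr_ge0 t; have p0 := pi_ge0 R.
have p4 : pi <= 4 :> R by have := pihalf_lt2 R; lra.
have := @cos_ge_quadratic R (2 * pi * `|t|); rewrite !mulr_ge0// => /(_ isT).
have : (2 * pi * `|t|) ^+ 2 <= (8 * `|t|) ^+ 2.
  rewrite lerXn2r ?nnegrE ?mulr_ge0//; nra.
by move=> ? ?; lra.
Qed.

End LowerTools.

(** * Size of the exponential sum near rationals *)

Section NearRationals.
Variable R : realType.
Implicit Types (k u v n d r a N : nat) (al be : R).

(** If [q] does not divide [D * A], then [D * al] stays at distance at least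
    1/(2q) from the integers. *)
Lemma cmod_progression_off_arc q u v al (A D : nat) (be : R) : (u <= v)%N ->
  (0 < q)%N -> (0 < D)%N -> ~~ (q %| D * A)%N ->
  al = A%:R / q%:R + be -> 0 <= al -> q%:R * D%:R * `|be| <= 1 / 2 ->
  cmod (progression D u v al) <= 4 * q%:R.
Proof.
move=> uv q0 D0 ndvd alE al0 small.
have Q0 : 0 < q%:R :> R by rewrite ltr0n.
rewrite progressionE//.
have z0 : 0 <= D%:R * al + 1 / 2 by rewrite addr_ge0 ?mulr_ge0.
pose n := Num.truncn (D%:R * al + 1 / 2).
have /andP[n1 n2] : n%:R <= D%:R * al + 1 / 2 < n.+1%:R by rewrite truncn_itv.
clearbody n; rewrite -[n.+1%:R]natr1 in n2.
pose t := D%:R * al - n%:R.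
have t2 : `|t| <= 1 / 2 by rewrite ler_norml /t; apply/andP; split; lra.
have E : D%:R * al = n%:R + t by rewrite /t; ring.
rewrite E; set G := geom _ _ _.
have AB : ((u %/ D).+1 <= (v %/ D).+1)%N by rewrite ltnS leq_div2r.
have H := cmod_geom_mul n AB t2; rewrite -/G in H.
have qt : q%:R * t = (D * A)%:R - (n * q)%:R + q%:R * D%:R * be.
  by rewrite /t alE !natrM; field; rewrite gt_eqF.
have int1 : 1 <= `|(D * A)%:R - (n * q)%:R : R|.
  have ne : (D * A != n * q)%N by apply: contra ndvd => /eqP ->; rewrite dvdn_mull.
  have [lt|ge] := ltnP (D * A) (n * q).
    by rewrite distrC ger0_norm ?subr_ge0 ?ler_nat 1?ltnW// -natrB 1?ltnW// ler1n subn_gt0.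
  rewrite ger0_norm ?subr_ge0 ?ler_nat// -natrB// ler1n subn_gt0.
  by rewrite ltn_neqAle eq_sym ne.
have qt2 : 1 / 2 <= q%:R * `|t|.
  rewrite -[q%:R in leRHS]ger0_norm// -normrM qt.
  have := lerB_normD ((D * A)%:R - (n * q)%:R : R) (q%:R * D%:R * be).
  rewrite [`|q%:R * D%:R * be|]normrM ger0_norm ?mulr_ge0//.
  by move=> ?; lra.
have G0 := cmod_ge0 G.
have h1 := ler_wpM2r G0 qt2; have h2 := ler_wpM2l (ltW Q0) H.
by rewrite mulrA in h2; lra.
Qed.

(** If [q] divides [D * A], every term e(n al) equals e(n be), which hardly
    changes over the interval. *)
Lemma cmod_progression_on_arc q u v al (A : nat) be D : (u < v)%N ->
  (0 < q)%N -> (q %| D * A)%N -> (0 < D)%N ->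
  al = A%:R / q%:R + be -> (v - u)%:R * `|be| <= 1 / 256 ->
  forall M : R, M = \sum_(u.+1 <= n < v.+1 | (D %| n)%N) 1 ->
  cmod (progression D u v al - M%:C%C * e (v%:R * be)) <= M / 32.
Proof.
move=> uv q0 qDA D0 alE small M ME.
have Q0 : q%:R != 0 :> R by rewrite pnatr_eq0 -lt0n.
have -> : progression D u v al - M%:C%C * e (v%:R * be) =
    \sum_(u.+1 <= n < v.+1 | (D %| n)%N) (e (n%:R * be) - e (v%:R * be)).
  rewrite sumrB; congr (_ - _).
    rewrite /progression /trigpoly [RHS]big_mkcond; apply: eq_bigr => n _.
    case: ifP => [Dn|_]; last by rewrite mul0r.
    rewrite mul1r alE mulrDr eD.
    have /dvdnP[w ew] : (q %| n * A)%N.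
      by case/dvdnP: Dn => w ->; rewrite -mulnA dvdn_mull.
    have -> : n%:R * (A%:R / q%:R) = w%:R :> R by rewrite mulrA -natrM ew natrM mulfK.
    by rewrite e_nat mul1r.
  by rewrite ME rmorph_sum mulr_suml; apply: eq_bigr => n _; rewrite mul1r.
apply: le_trans (cmod_sum _ _ _) _; rewrite ME mulr_suml.
rewrite big_nat_cond [leRHS]big_nat_cond; apply: ler_sum => n /andP[/andP[un nv] _].
apply: le_trans (cmod_e_sub_le _ _) _; rewrite -mulrBl normrM.
have : `|n%:R - v%:R| <= (v - u)%:R :> R.
  rewrite distrC ger0_norm ?subr_ge0 ?ler_nat// -natrB// ler_nat leq_sub2l// ltnW//.
move=> /(ler_wpM2r (normr_ge0 be)) h; lra.
Qed.

Lemma sum_multiples_count k u v r N : (2 <= k)%N -> (u < v)%N -> (0 < r)%N ->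
  \sum_(1 <= d < v.+1 | (d <= N)%N && (r %| d)%N)
     \sum_(u.+1 <= n < v.+1 | (d ^ k %| n)%N) (1 : R) <=
  7 / 4 * ((v - u)%:R / r%:R ^+ k) + N%:R.
Proof.
move=> k2 uv r0; set X := (v - u)%:R / r%:R ^+ k.
have X0 : 0 <= X by rewrite divr_ge0 ?exprn_ge0.
have M0 d : 0 <= \sum_(u.+1 <= n < v.+1 | (d ^ k %| n)%N) (1 : R) by apply: sumr_ge0.
apply: (@le_trans _ _ (\sum_(1 <= d < N.+1 | (r %| d)%N)
     \sum_(u.+1 <= n < v.+1 | (d ^ k %| n)%N) (1 : R))).
  have [vN|Nv] := leqP v.+1 N.+1.
    rewrite [leRHS](@big_cat_nat _ _ _ v.+1)//= -[leLHS]addr0; apply: lerD; last exact: sumr_ge0.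
    rewrite [leLHS]big_mkcond [leRHS]big_mkcond; apply: ler_sum => d _.
    by case: (d <= N)%N; case: (r %| d)%N.
  rewrite (@big_cat_nat _ _ _ N.+1 1 v.+1)//= 1?ltnW// [X in _ + X](_ : _ = 0) ?addr0; last first.
    rewrite big_nat_cond big1// => d /andP[/andP[Nd _] /andP[dN _]].
    by move: Nd; rewrite ltnNge dN.
  rewrite big_nat_cond [leRHS]big_nat_cond; apply: eq_ler; apply: eq_bigl => d.
  by rewrite ltnS; case: (d <= N)%N; rewrite ?andbF ?andbT//=.
apply: (@le_trans _ _ (\sum_(1 <= d < N.+1 | (r %| d)%N) ((v - u)%:R * d%:R ^- k + 1))).
  rewrite big_nat_cond [leRHS]big_nat_cond; apply: ler_sum => d /andP[/andP[d0 _] _].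
  have := @count_multiples_dist R u v (d ^ k) _ (ltnW uv); rewrite expn_gt0 d0 => /(_ isT).
  by rewrite ler_norml natrX => /andP[_]; rewrite lerBlDl addrC.
rewrite big_split /= [X in _ + X](_ : _ = (N %/ r)%:R); last first.
  by rewrite (@count_multiplesE R 0 N r r0) div0n subn0.
apply: lerD; last by rewrite ler_nat leq_div.
rewrite (@sum_multiples_itv _ r 0 N (fun d => (v - u)%:R * d%:R ^- k : R) r0) div0n.
rewrite (eq_bigr (fun m => X * m%:R ^- k)); last first.
  by move=> m _; rewrite natrM exprMn invfM /X mulrA.
rewrite -mulr_sumr mulrC ler_wpM2r//.
case: (N %/ r)%N => [|n]; first by rewrite big_geq//; lra.
rewrite big_ltn// expr1n invr1; have := @sum_invpow_ge2 R k n.+2 k2; lra.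
Qed.

End NearRationals.

Section OnArcs.
Variable R : realType.
Implicit Types (k u v n d r a N : nat) (al be : R).

Lemma sum_const_count (s : seq nat) (P : pred nat) (c : R) :
  \sum_(i <- s | P i) c = (count P s)%:R * c.
Proof. by rewrite big_const_seq iter_addr_0 -[_ *+ count _ _]mulr_natl. Qed.

Lemma div_exprS (x : R) k : x != 0 -> (0 < k)%N -> x / x ^+ k = x ^- k.-1.
Proof. by case: k => // k x0 _; rewrite exprS invfM mulrA mulfV// mul1r. Qed.

Lemma cutoff_tail_size k r : (2 <= k)%N -> (0 < r)%N -> (64 * r ^ k <= (64 * r ^ 2) ^ k.-1)%N.
Proof.
move=> k2 r0; rewrite expnMn leq_mul//; last by rewrite -expnM leq_pexp2l//; lia.
by rewrite -{1}[64%N]expn1 leq_pexp2l//; lia.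
Qed.

Lemma cutoff_sizes k r : (2 <= k)%N -> (0 < r)%N ->
  (256 * (r ^ k) ^ 2 * (64 * r ^ 2) <= (64 * r) ^ (6 * k))%N /\
  (r ^ k * (64 * r ^ 2) ^ k <= (64 * r) ^ (6 * k))%N.
Proof.
move=> k2 r0; have m0 : (0 < 64 * r)%N by rewrite muln_gt0.
split.
  apply: (@leq_trans ((64 * r) ^ (2 * k + 2))); last by rewrite leq_pexp2l//; lia.
  rewrite expnMn (_ : 256 * (r ^ k) ^ 2 * (64 * r ^ 2) = 64 * 256 * r ^ (2 * k + 2))%N; last first.
    rewrite expnD (mulnC 2 k) expnM.
    move: ((r ^ k) ^ 2)%N (r ^ 2)%N => x y; lia.
  rewrite leq_mul2r; apply/orP; right.
  by apply: (@leq_trans (64 ^ 3)); rewrite // leq_pexp2l//; lia.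
apply: (@leq_trans ((64 * r) ^ (3 * k))); last by rewrite leq_pexp2l//; lia.
rewrite -expnMn expnM leq_exp2r; last lia.
by rewrite !expnS expn0; clear -r0; nia.
Qed.

(** This is why k-free numerators suffice: a / r^k need not be in lowest terms,
    but no denominator prime cancels completely. *)
Lemma dvdn_exp_kfree k r a d : (0 < k)%N -> kfree 2 r -> kfree k a ->
  (r ^ k %| d ^ k * a)%N -> (r %| d)%N.
Proof.
move=> k0 sr ka rda; apply: kfree2_dvdn => // p pp pr.
apply: contraT => pd; have := ka p pp; rewrite -(@Gauss_dvdr _ (d ^ k)).
  by rewrite (dvdn_trans _ rda)// dvdn_exp2r.
by rewrite coprimeXl// coprimeXr// prime_coprime.
Qed.

(** Among the terms with r | d, the one with [d = r] contributes X - 1 or more,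
    the others at most 3 X / 4 plus rounding errors: X / 4 is left.  The
    fraction with denominator 32 is the variation of the phase, and the last
    error comes from the [d] that are not divisible by [r]. *)
Lemma cmod_low_ge k u v r a N al be : (2 <= k)%N -> (u < v)%N ->
  kfree 2 r -> kfree k a -> (r <= v)%N -> (r <= N)%N ->
  al = a%:R / (r ^ k)%:R + be -> 0 <= al -> (v - u)%:R * `|be| <= 1 / 256 ->
  (r ^ k)%:R * (N ^ k)%:R * `|be| <= 1 / 2 ->
  forall X : R, X = (v - u)%:R / (r ^ k)%:R ->
  X / 4 - N%:R - 2 - (7 / 4 * X + N%:R) / 32 - N%:R * (4 * (r ^ k)%:R) <=
  cmod (trigpoly (mobius_low R k v N) u v al).
Proof.
move=> k2 uv sr ka rv rN alE al0 Hbe small X XE.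
have r0 := kfree_gt0 sr; have k0 : (0 < k)%N by exact: ltnW.
have q0 : (0 < r ^ k)%N by rewrite expn_gt0 r0.
pose M d : R := \sum_(u.+1 <= n < v.+1 | (d ^ k %| n)%N) 1.
have M0 d : 0 <= M d by apply: sumr_ge0.
pose P d := (d <= N)%N && (r %| d)%N.
pose P1 := \sum_(1 <= d < v.+1 | P d) (mobius R d)%:C%C * progression (d ^ k) u v al.
pose P2 := \sum_(1 <= d < v.+1 | (d <= N)%N && ~~ (r %| d)%N)
  (mobius R d)%:C%C * progression (d ^ k) u v al.
have split_low : trigpoly (mobius_low R k v N) u v al = P1 + P2.
  by rewrite trigpoly_low (bigID (fun d => r %| d)%N).
have boundP2 : cmod P2 <= N%:R * (4 * (r ^ k)%:R).
  apply: le_trans (cmod_sum _ _ _) _.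
  apply: (@le_trans _ _ (\sum_(1 <= d < N.+1) (4 * (r ^ k)%:R))); last first.
    by rewrite sumr_const_nat subn1 -[_ *+ _.-1]mulr_natl.
  apply: (@le_trans _ _ (\sum_(1 <= d < v.+1 | (d <= N)%N) (4 * (r ^ k)%:R))).
    rewrite [leLHS]big_nat_cond [leRHS]big_nat_cond [leLHS]big_mkcond [leRHS]big_mkcond.
    apply: ler_sum => d _; case: ifP => [/andP[/andP[d0 dv] /andP[dN rd]]|_]; last first.
      by case: ifP => // _; rewrite mulr_ge0.
    rewrite d0 dv dN /= cmodM cmod_real.
    apply: le_trans (ler_wpM2r (cmod_ge0 _) (mobius_norm_le1 R d)) _; rewrite mul1r.
    apply: (@cmod_progression_off_arc R (r ^ k) u v al a (d ^ k) be (ltnW uv) q0) => //.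
      by rewrite expn_gt0 d0.
      by apply: contra rd; exact: dvdn_exp_kfree.
    by apply: le_trans small; rewrite ler_wpM2r// ler_wpM2l// ler_nat leq_exp2r.
  rewrite [leLHS]sum_const_count [leRHS]sum_const_count ler_wpM2r ?mulr_ge0// ler_nat.
  rewrite -!size_filter; apply: uniq_leq_size; first by rewrite filter_uniq ?iota_uniq.
  by move=> d; rewrite !mem_filter !mem_index_iota => /andP[dN /andP[d0 _]]; rewrite /= d0 ltnS dN.
pose W := \sum_(1 <= d < v.+1 | P d) mobius R d * M d.
have sumM : \sum_(1 <= d < v.+1 | P d) M d <= 7 / 4 * X + N%:R.
  by rewrite XE natrX; exact: sum_multiples_count.
have boundP1 : cmod (P1 - W%:C%C * e (v%:R * be)) <= (7 / 4 * X + N%:R) / 32.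
  rewrite /W rmorph_sum mulr_suml -sumrB.
  apply: le_trans (cmod_sum _ _ _) _.
  apply: (@le_trans _ _ (\sum_(1 <= d < v.+1 | P d) M d / 32)); last first.
    by rewrite -mulr_suml ler_wpM2r.
  rewrite big_nat_cond [leRHS]big_nat_cond; apply: ler_sum => d /andP[/andP[d0 _] /andP[_ rd]].
  rewrite rmorphM -mulrA -mulrBr cmodM cmod_real.
  apply: le_trans (ler_wpM2r (cmod_ge0 _) (mobius_norm_le1 R d)) _; rewrite mul1r.
  apply: (@cmod_progression_on_arc R (r ^ k) u v al a be (d ^ k) uv q0) => //.
    by rewrite dvdn_mulr// dvdn_exp2r.
  by rewrite expn_gt0 d0.
have boundW : X / 4 - N%:R - 2 <= `|W|.
  have rin : r \in index_iota 1 v.+1 by rewrite mem_index_iota r0 ltnS.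
  have Pr : P r by rewrite /P rN dvdnn.
  move: sumM; rewrite /W (big_rem r)//= Pr [in X in _ -> X](big_rem r)//= Pr => sumM.
  set S := \sum_(_ <- rem _ _ | _) M _ in sumM.
  set T := \sum_(_ <- _ | _) _.
  have TS : `|T| <= S.
    apply: le_trans (ler_norm_sum _ _ _) _; apply: ler_sum => d _.
    by rewrite normrM (ger0_norm (M0 d)) ler_piMl ?M0 ?mobius_norm_le1.
  have Mr : X - 1 <= M r.
    have := @count_multiples_dist R u v (r ^ k) q0 (ltnW uv).
    by rewrite -/(M r) -XE ler_norml => /andP[h _]; lra.
  have := lerB_normD (mobius R r * M r) T.
  rewrite normrM mobius_norm1// mul1r (ger0_norm (M0 r)) => h; lra.
have We : cmod (W%:C%C * e (v%:R * be)) = `|W| by rewrite cmodM cmod_e cmod_real mulr1.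
have tri1 : `|W| <= cmod P1 + cmod (P1 - W%:C%C * e (v%:R * be)).
  rewrite -We; set w := W%:C%C * _.
  have {1}-> : w = P1 + - (P1 - w) by ring.
  by apply: le_trans (cmodD _ _) _; rewrite cmodN.
have tri2 := cmodD (P1 + P2) (- P2).
rewrite addrK cmodN in tri2.
rewrite split_low; lra.
Qed.

(** The cut [N = 64 * r ^ 2] is large enough for the tail beyond it to be a
    small fraction of H / r^k, and small enough for the errors below it. *)
Lemma pointwise_lower k u v r a al : (2 <= k)%N -> (u < v)%N ->
  (1 - 2 * eta R k) * ln v%:R <= 2 * ln (v - u)%:R :> R ->
  kfree 2 r -> kfree k a -> ((64 * r) ^ (6 * k) <= v - u)%N ->
  64 * ((24 + 6 * k%:R) * expR (2 * ln (v - u)%:R / (k%:R + 1))) * (r ^ k)%:R <= (v - u)%:R :> R ->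
  0 <= al -> a%:R / (r ^ k)%:R - (256 * (v - u)%:R)^-1 <= al <= a%:R / (r ^ k)%:R ->
  (v - u)%:R / (16 * (r ^ k)%:R) <= cmod (trigpoly (mu_k R k) u v al).
Proof.
move=> k2 uv hyp sr ka rH CH al0 /andP[alL alU].
have r0 := kfree_gt0 sr.
have [size1 size2] := cutoff_sizes k2 r0.
have {}size1 := leq_trans size1 rH; have {}size2 := leq_trans size2 rH.
have k0 : (0 < k)%N by lia.
have h64 : (64 * r <= (64 * r) ^ (6 * k))%N by rewrite leq_expl// muln_gt0.
have rv : (r <= v)%N.
  by apply: (@leq_trans (64 * r)); [rewrite leq_pmull|apply: leq_trans h64 _; apply: leq_trans rH (leq_subr _ _)].
move: (((64 * r) ^ (6 * k))%N) h64 rH => Z h64 rH.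
pose q := (r ^ k)%N; pose N := (64 * r ^ 2)%N.
have q0 : (0 < q)%N by rewrite expn_gt0 r0.
set H : R := (v - u)%:R in CH alL *.
have H1 : 1 <= H by rewrite ler1n subn_gt0.
have H0 : 0 < H by lra.
have Q1 : 1 <= q%:R :> R by rewrite ler1n.
have Q0 : 0 < q%:R :> R by lra.
rewrite -/q in alL alU CH.
pose be := al - a%:R / q%:R.
have alE : al = a%:R / q%:R + be by rewrite /be; ring.
have be1 : `|be| <= (256 * H)^-1.
  rewrite ler_norml; apply/andP; split; first by rewrite /be; lra.
  apply: (@le_trans _ _ 0); first by rewrite /be subr_le0.
  by rewrite invr_ge0; apply: mulr_ge0; [exact: ler0n|exact: ltW].
have Hbe : H * `|be| <= 1 / 256.
  apply: le_trans (ler_wpM2l (ltW H0) be1) _; apply: eq_ler.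
  by field; rewrite gt_eqF.
pose X := H / q%:R.
have XQ : X * q%:R = H by rewrite /X divfK// gt_eqF.
have QNX : 256 * q%:R * N%:R <= X.
  rewrite /X ler_pdivlMr// mulrAC -!natrM ler_nat; apply: leq_trans size1.
  by rewrite -/q -/N !expnS expn0 muln1 !mulnA.
have N64 : 64 <= N%:R :> R.
  by rewrite ler_nat /N leq_pmulr// expn_gt0 r0.
pose E1 : R := (24 + 6 * k%:R) * expR (2 * ln H / (k%:R + 1)).
have hi : cmod (trigpoly (mobius_high R k v N) u v al) <= X / 16 + X / 64.
  apply: le_trans (cmod_trigpoly_le _ _ _ _) _.
  apply: (@le_trans _ _ (\sum_(1 <= d < v.+1 | (N < d)%N) \sum_(u.+1 <= n < v.+1 | (d ^ k %| n)%N) (1 : R))).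
    rewrite [leRHS](eq_bigr (fun d => \sum_(u.+1 <= n < v.+1) if (d ^ k %| n)%N then 1 else 0)); last first.
      by move=> d _; rewrite [LHS]big_mkcond.
    rewrite exchange_big /=; apply: ler_sum => n _.
    apply: le_trans (ler_norm_sum _ _ _) _; rewrite -big_mkcondr.
    by apply: ler_sum => d _; exact: mobius_norm_le1.
  apply: le_trans (tail_count_le N v.+1 k2 uv hyp) _; rewrite -/H -/E1; apply: lerD.
    rewrite div_exprS ?pnatr_eq0//.
    have tail : (64 * q <= N.+1 ^ k.-1)%N.
      apply: leq_trans (cutoff_tail_size k2 r0) _; rewrite leq_exp2r ?leqnSn//.
      by rewrite -ltnS prednK.
    have : 64 * q%:R <= N.+1%:R ^+ k.-1 :> R.
      by rewrite -natrM -natrX ler_nat.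
    move=> h; have : (N.+1%:R ^+ k.-1)^-1 <= (64 * q%:R)^-1 :> R.
      by rewrite lef_pV2 ?posrE// ?mulr_gt0 ?exprn_gt0.
    move=> /(ler_wpM2l (_ : 0 <= 4 * H)) h2; apply: le_trans (h2 _) _; first by rewrite mulr_ge0// ltW.
    by apply: eq_ler; rewrite /X; field; rewrite gt_eqF.
  rewrite ler_pdivlMr// /X ler_pdivlMr// -/q in CH *.
  by apply: le_trans CH; apply: eq_ler; rewrite /E1; ring.
have qNbe : q%:R * (N ^ k)%:R * `|be| <= 1 / 2.
  apply: (@le_trans _ _ (H * `|be|)); last by lra.
  by rewrite ler_wpM2r// -natrM ler_nat.
have rN : (r <= N)%N by rewrite /N expnS expn1 mulnA leq_pmull// muln_gt0.
have low := @cmod_low_ge k u v r a N al be k2 uv sr ka rv rN alE al0 Hbe qNbe X erefl.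
have := cmodD (trigpoly (mu_k R k) u v al) (- trigpoly (mobius_high R k v N) u v al).
rewrite cmodN {1}(@trigpoly_mu_split _ k u v N)// addrK => tri.
have -> : H / (16 * (r ^ k)%:R) = X / 16 by rewrite /X -/q; field; rewrite gt_eqF.
have QN : N%:R <= q%:R * N%:R :> R by rewrite ler_peMl.
rewrite -/q in low; rewrite -mulrA in QNX; rewrite [N%:R * _]mulrCA [N%:R * _]mulrC in low.
have N2 : 2 <= N%:R :> R by lra.
move: (q%:R * N%:R) QN QNX low => y QN QNX low; lra.
Qed.

End OnArcs.

(** * Lower bound for the moment *)

Section MomentLower.
Variable R : realType.
Implicit Types (k u v n d r a N : nat) (al be : R).

(** The primes of [r] are those at which the fraction has negative valuation. *)
Lemma kfree_frac_inj k r a r' a' : (0 < k)%N -> kfree 2 r -> kfree k a ->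
  kfree 2 r' -> kfree k a' -> (a * r' ^ k = a' * r ^ k)%N -> r = r' /\ a = a'.
Proof.
move=> k0 sr ka sr' ka' E.
have rr' : r = r'.
  by apply/eqP; rewrite eqn_dvd (@dvdn_exp_kfree k r a r')//
    ?(@dvdn_exp_kfree k r' a' r)//; [rewrite mulnC -E dvdn_mull|rewrite mulnC E dvdn_mull].
split=> //; move/eqP: E; rewrite rr' eqn_pmul2r ?expn_gt0 ?(kfree_gt0 sr')// => /eqP//.
Qed.

(** Distinct fractions of denominators [q] and [q'] differ by 1/(q q') at
    least. *)
Lemma arc_unique (a a' q q' : nat) (c al : R) : (0 < q)%N -> (0 < q')%N ->
  q%:R * q'%:R * c < 1 ->
  a%:R / q%:R - c <= al <= a%:R / q%:R -> a'%:R / q'%:R - c <= al <= a'%:R / q'%:R ->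
  (a * q' = a' * q)%N.
Proof.
move=> q0 q0' small /andP[h1 h2] /andP[h3 h4].
have Q0 : 0 < q%:R :> R by rewrite ltr0n.
have Q0' : 0 < q'%:R :> R by rewrite ltr0n.
have QQ : 0 <= q%:R * q'%:R :> R by rewrite mulr_ge0.
have e1 : q%:R * q'%:R * (a%:R / q%:R) = (a * q')%:R :> R by rewrite natrM; field; rewrite gt_eqF.
have e2 : q%:R * q'%:R * (a'%:R / q'%:R) = (a' * q)%:R :> R by rewrite natrM; field; rewrite gt_eqF.
have lt1 (x y : nat) : x%:R - y%:R < 1 :> R -> (x <= y)%N.
  by move=> xy; rewrite -ltnS -(ltr_nat R) -[y.+1%:R]natr1; lra.
apply/eqP; rewrite eqn_leq !lt1 //.
- have := ler_wpM2l QQ (_ : a'%:R / q'%:R - a%:R / q%:R <= c); rewrite mulrBr e1 e2 => /(_ _) h.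
  by apply: le_lt_trans (h _) small; lra.
- have := ler_wpM2l QQ (_ : a%:R / q%:R - a'%:R / q'%:R <= c); rewrite mulrBr e1 e2 => /(_ _) h.
  by apply: le_lt_trans (h _) small; lra.
Qed.

Lemma powR_inv_exp k (x : R) : (0 < k)%N -> 0 < x ->
  (x ^- k) `^ (1 + k%:R^-1) = x ^- k * x^-1.
Proof.
move=> k0 x0; have y0 : 0 < x ^- k by rewrite invr_gt0 exprn_gt0.
rewrite powRD; last by rewrite (gt_eqF y0) implybT.
rewrite powRr1 ?ltW//; congr (_ * _).
rewrite -exprVn -powR_mulrn ?invr_ge0 ?ltW// -powRrM mulfV ?pnatr_eq0 -?lt0n//.
by rewrite powRr1// invr_ge0 ltW.
Qed.

(** The moment is compared with the sum of the indicators of the arcs, each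
    weighted by the lower bound for |S|^p on it. *)
Lemma moment_lower k u v : (2 <= k)%N -> (u < v)%N ->
  (1 - 2 * eta R k) * ln v%:R <= 2 * ln (v - u)%:R :> R ->
  6 * ln (64 * (24 + 6 * k%:R)) <= ln (v - u)%:R :> R ->
  12 * k%:R * ln 64 <= ln (v - u)%:R :> R ->
  16^-1 ^+ 2 / 1024 / (48 * k%:R) * (expR (ln (v - u)%:R / k%:R) * ln (v - u)%:R) <=
  int01 (fun al => cmod (trigpoly (mu_k R k) u v al) `^ (1 + k%:R^-1)).
Proof.
move=> k2 uv hyp hyp1 hyp2; have k0 : (0 < k)%N by exact: ltnW.
set h : R := ln (v - u)%:R in hyp1 hyp2 *.
set K : R := k%:R in hyp1 hyp2 *; have K2 : 2 <= K by rewrite ler_nat.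
have K0 : 0 < K by lra.
set H : R := (v - u)%:R.
have H1 : 1 <= H by rewrite ler1n subn_gt0.
have H0 : 0 < H by lra.
have HE : H = expR h by rewrite lnK// posrE.
have h0 : 0 <= h by exact: ln_ge0.
set p := 1 + K^-1.
have KV0 : 0 < K^-1 by rewrite invr_gt0.
have p0 : 0 <= p by rewrite /p; lra.
pose c := (256 * H)^-1.
have c0 : 0 < c by rewrite invr_gt0; apply: mulr_gt0; [rewrite ltr0n|].
(* For r <= R0 one has r^k <= H^(1/6): the arcs are disjoint, and the error term
   H^(2/(k+1)) <= H^(2/3) is smaller than H / r^k. *)
pose R0 := Num.truncn (expR (h / (6 * K)) / 64).
have rle r : (r < R0.+1)%N -> 64 * r%:R <= expR (h / (6 * K)).
  rewrite ltnS truncn_ge_nat ?divr_ge0 ?expR_ge0// ler_pdivlMr// mulrC//.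
have rq r : (r < R0.+1)%N -> (r ^ k)%:R <= expR (h / 6).
  move=> /rle hr; rewrite natrX (_ : h / 6 = K * (h / (6 * K))); last by field; rewrite gt_eqF.
  rewrite expRM_natl lerXn2r ?nnegrE ?expR_ge0//; have := ler0n R r; lra.
have rsize r : (r < R0.+1)%N -> ((64 * r) ^ (6 * k) <= v - u)%N.
  move=> /rle hr; rewrite -(ler_nat R) -/H HE natrX natrM.
  rewrite (_ : h = (6 * k)%:R * (h / (6 * K))); last by rewrite natrM; field; rewrite gt_eqF.
  by rewrite expRM_natl lerXn2r ?nnegrE ?expR_ge0 ?mulr_ge0.
have rCH r : (r < R0.+1)%N ->
    64 * ((24 + 6 * K) * expR (2 * h / (K + 1))) * (r ^ k)%:R <= H.
  move=> /rq hr; set C1 := 24 + 6 * K in hyp1 *.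
  have C10 : 0 < 64 * C1 by rewrite mulr_gt0// /C1; lra.
  have c1 : 64 * C1 <= expR (h / 6).
    by rewrite -[leLHS]lnK ?posrE// ler_expR; lra.
  have e2 : expR (2 * h / (K + 1)) <= expR (2 / 3 * h).
    rewrite ler_expR mulrAC ler_wpM2r//.
    by rewrite ler_pdivrMr; lra.
  apply: (@le_trans _ _ (expR (h / 6) * expR (2 / 3 * h) * expR (h / 6))).
    have X0 : 0 <= 64 * C1 * expR (2 * h / (K + 1)) by rewrite mulr_ge0 ?expR_ge0// ltW.
    by rewrite mulrA ler_pM// ler_pM ?expR_ge0// ltW.
  by rewrite HE -!expRD ler_expR; lra.
pose G r a : R -> R := itv_ind (a%:R / (r ^ k)%:R - c) (a%:R / (r ^ k)%:R).
pose w r : R := (H / (16 * (r ^ k)%:R)) `^ p.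
pose S al := cmod (trigpoly (mu_k R k) u v al).
have Gne r a al : w r * G r a al != 0 ->
    a%:R / (r ^ k)%:R - c <= al <= a%:R / (r ^ k)%:R.
  by rewrite /G /itv_ind; case: (_ <= _ <= _) => //; rewrite mulr0 eqxx.
have itG r a : integrable01 (fun al => w r * G r a al) by apply: integrable01Z; exact: integrable01_ind.
have pointwise al : 0 <= al <= 1 ->
    \sum_(1 <= r < R0.+1 | `[< kfree 2 r >])
      \sum_(1 <= a < (r ^ k).+1 | `[< kfree k a >]) w r * G r a al <= S al `^ p.
  move=> /andP[al0 _].
  have arcs r a r' a' : r \in index_iota 1 R0.+1 -> r' \in index_iota 1 R0.+1 ->
      `[< kfree 2 r >] -> `[< kfree 2 r' >] -> `[< kfree k a >] -> `[< kfree k a' >] ->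
      w r * G r a al != 0 -> w r' * G r' a' al != 0 -> r = r' /\ a = a'.
    rewrite !mem_index_iota => /andP[r0 rR] /andP[r0' rR'] /asboolP sr /asboolP sr' /asboolP ka /asboolP ka'.
    move=> /Gne ar /Gne ar'; apply: (@kfree_frac_inj k) => //.
    apply: arc_unique ar ar'; rewrite ?expn_gt0 ?r0 ?r0'//.
    apply: (@le_lt_trans _ _ (H * c)); last first.
      by rewrite /c (_ : H * _ = 1 / 256); [lra|field; rewrite gt_eqF].
    rewrite ler_wpM2r ?(ltW c0)// HE; apply: (@le_trans _ _ (expR (h / 6) * expR (h / 6))).
      by rewrite ler_pM// rq.
    by rewrite -expRD ler_expR; lra.
  apply: sum_at_most_one; rewrite ?iota_uniq ?powR_ge0//.
    move=> r rin sr; apply: sum_at_most_one; rewrite ?iota_uniq ?powR_ge0//.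
      move=> a; rewrite mem_index_iota => /andP[a0 aq] ka.
      have [->|ne] := eqVneq (w r * G r a al) 0; first by rewrite powR_ge0.
      have arc := Gne _ _ _ ne.
      move: rin; rewrite mem_index_iota => /andP[r0 rR].
      have low := pointwise_lower k2 uv hyp (asboolW sr) (asboolW ka) (rsize _ rR) (rCH _ rR) al0 arc.
      apply: (@le_trans _ _ (w r)).
        by rewrite ler_piMr ?powR_ge0// /G /itv_ind; case: (_ <= _ <= _).
      apply: ge0_ler_powR => //; rewrite ?nnegrE ?cmod_ge0//.
      by rewrite divr_ge0 ?mulr_ge0// ltW.
    by move=> a a' _ _ ka ka' n1 n2; have [] := arcs r a r a' rin rin sr sr ka ka' n1 n2.
  have nz r : \sum_(1 <= a < (r ^ k).+1 | `[< kfree k a >]) w r * G r a al != 0 ->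
      exists2 a, `[< kfree k a >] & w r * G r a al != 0.
    move=> ne; apply: contrapT => no; move: ne; rewrite big1 ?eqxx// => a ka.
    by apply/eqP; apply: contraT => ne; case: no; exists a.
  move=> r r' rin rin' sr sr' /nz[a ka na] /nz[a' ka' na'].
  by have [] := arcs r a r' a' rin rin' sr sr' ka ka' na na'.
apply: (@le_trans _ _ (int01 (fun al => \sum_(1 <= r < R0.+1 | `[< kfree 2 r >])
      \sum_(1 <= a < (r ^ k).+1 | `[< kfree k a >]) w r * G r a al))); last first.
  apply: le_int01; [|exact: integrable01_cmod_powR|exact: pointwise].
  by apply: integrable01_sum => r _; apply: integrable01_sum.
rewrite int01_sum; last by move=> r _; apply: integrable01_sum.
pose Z := (H / 16) `^ p * c / 4.
have Z0 : 0 <= Z by rewrite divr_ge0// mulr_ge0 ?powR_ge0 ?ltW.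
apply: (@le_trans _ _ (\sum_(1 <= r < R0.+1 | `[< kfree 2 r >]) (Z * r%:R^-1))); last first.
  rewrite big_nat_cond [leRHS]big_nat_cond; apply: ler_sum => r /andP[/andP[r0 rR] _].
  have rk0 : (0 < r ^ k)%N by rewrite expn_gt0 r0.
  have Q0 : 0 < (r ^ k)%:R :> R by rewrite ltr0n.
  rewrite int01_sum//.
  apply: (@le_trans _ _ (\sum_(1 <= a < (r ^ k).+1 | `[< kfree k a >]) (w r * c))); last first.
    rewrite big_nat_cond [leRHS]big_nat_cond; apply: ler_sum => a /andP[/andP[a0 aq] _].
    rewrite int01Z; last exact: integrable01_ind.
    rewrite /G int01_itv_ind.
    - by rewrite opprB addrC subrK.
    - rewrite subr_ge0; apply: (@le_trans _ _ (1 / (r ^ k)%:R)); last first.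
        by rewrite ler_pM2r ?invr_gt0// ler1n.
      rewrite mul1r lef_pV2; [|by rewrite posrE -invr_gt0|by rewrite posrE].
      apply: (@le_trans _ _ H); last by lra.
      by apply: le_trans (rq _ rR) _; rewrite HE ler_expR; lra.
    - by rewrite gerBl ltW.
    - by rewrite ler_pdivrMr// mul1r ler_nat -ltnS.
  rewrite (eq_bigr (fun=> w r * c * 1)); last by move=> a _; rewrite mulr1.
  rewrite -mulr_sumr; apply: (@le_trans _ _ (w r * c * ((r ^ k)%:R / 4))); last first.
    by rewrite ler_wpM2l ?count_kfree// mulr_ge0 ?powR_ge0// ltW.
  apply: eq_ler.
  have -> : w r = (H / 16) `^ p * (r%:R ^- k * r%:R^-1).
    rewrite /w -powR_inv_exp ?ltr0n// -powRM ?divr_ge0 ?invr_ge0 ?exprn_ge0 ?(ltW H0)//.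
    by rewrite natrX invfM mulrA.
  rewrite /Z natrX; field.
  by rewrite expf_neq0 pnatr_eq0 -lt0n r0.
rewrite -mulr_sumr.
apply: (@le_trans _ _ (Z * (ln R0.+1%:R / 4))); last by rewrite ler_wpM2l// sum_inv_sqfree.
(* Half of log H / (6k) absorbs the denominator 64 of R0. *)
have lnR : h / (12 * K) <= ln R0.+1%:R.
  apply: (@le_trans _ _ (ln (expR (h / (6 * K)) / 64))); last first.
    by rewrite ler_ln ?posrE ?ltr0n ?divr_gt0 ?expR_gt0// ltW// truncnS_gt.
  rewrite ln_div ?posrE ?expR_gt0// expRK.
  have : ln 64 <= h / (12 * K) by rewrite ler_pdivlMr ?mulr_gt0// mulrC.
  have -> : h / (6 * K) = h / (12 * K) + h / (12 * K) by field; rewrite gt_eqF.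
  by move=> ?; lra.
have ZE : expR (h / K) * (16^-1 ^+ 2 / 1024) <= Z.
  have -> : Z = expR (h / K) * ((16^-1 `^ p) / 1024).
    rewrite /Z powRM ?invr_ge0 ?(ltW H0)// /p powRD ?(gt_eqF H0) ?implybT//.
    rewrite powRr1 ?(ltW H0)// {2}HE -expRM /c -/p; field; rewrite gt_eqF//.
  rewrite ler_wpM2l ?expR_ge0//.
  have : 16^-1 `^ 2%:R <= 16^-1 `^ p :> R.
    apply: ger_powR; first by rewrite invr_gt0 ltr0n /= invf_le1// ler1n.
    have : K^-1 <= 1 by rewrite invf_le1//; lra.
    by rewrite /p => ?; lra.
  rewrite powR_mulrn ?invr_ge0// => h16.
  by rewrite ler_wpM2r ?invr_ge0 ?ler0n.
have lnR0 : 0 <= h / (12 * K) by rewrite divr_ge0// mulr_ge0// ltW.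
set c1 : R := 16^-1 ^+ 2 / 1024 in ZE *.
have c10 : 0 <= c1 by rewrite divr_ge0 ?ler0n ?exprn_ge0// invr_ge0 ler0n.
clearbody c1; apply: (@le_trans _ _ (expR (h / K) * c1 * (h / (12 * K) / 4))).
  by apply: eq_ler; field; rewrite gt_eqF.
have e4 : 0 <= 4^-1 :> R by rewrite invr_ge0.
apply: ler_pM; [by apply: mulr_ge0 => //; exact: expR_ge0|by apply: mulr_ge0|exact: ZE|by apply: ler_wpM2r].
Qed.

End MomentLower.

(** * The exponent and the passage to real end points *)

Section Conversions.
Variable R : realType.

(** Clearing denominators in [half_sub_eta_le_delta].  The quadratic factor is
    at least -9.75 everywhere, and nonnegative from 10 on. *)
Lemma delta_numerator (x : R) : 3 <= x ->
  16 * (x + 1) * (3 * x ^+ 3 - 6 * x ^+ 2 - x + 4) <=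
  3 * x ^+ 5 + 15 * x ^+ 4 + 33 * x ^+ 3 + 21 * x ^+ 2 + 14 * x + 10.
Proof.
move=> x3; rewrite -subr_ge0.
have -> : 3 * x ^+ 5 + 15 * x ^+ 4 + 33 * x ^+ 3 + 21 * x ^+ 2 + 14 * x + 10 -
    16 * (x + 1) * (3 * x ^+ 3 - 6 * x ^+ 2 - x + 4) =
    x ^+ 2 * (x * (3 * x ^+ 2 - 33 * x + 81) + 133) - 34 * x - 54 by ring.
have x0 : 0 <= x by lra.
have q : - 10 <= 3 * x ^+ 2 - 33 * x + 81 by have := sqr_ge0 (x - 11 / 2); rewrite sqrrB expr2; nra.
have b : 33 <= x * (3 * x ^+ 2 - 33 * x + 81) + 133.
  have [x10|x10] := leP x 10; first by have := ler_wpM2l x0 q; lra.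
  have : 0 <= 3 * x ^+ 2 - 33 * x + 81 by rewrite expr2; nra.
  by move=> /(mulr_ge0 x0) ?; lra.
have x9 : 3 * x <= x ^+ 2 by rewrite expr2; nra.
by have := ler_pM (mulr_ge0 (ler0n R 3) x0) (ler0n R 33) x9 b => ?; lra.
Qed.

Lemma half_sub_eta_le_delta (k : nat) : (2 <= k)%N ->
  1 / 2 - eta R k <= (k%:R + 1) / 2 * delta R k.
Proof.
move=> k2; rewrite /delta /eta; case: eqP => [->|/eqP nk].
  have -> : (32 * (2%:R + 1))^-1 = 1 / 96 :> R by field.
  by lra.
have x3 : 3 <= k%:R :> R by rewrite ler_nat ltn_neqAle eq_sym nk.
move: (k%:R : R) x3 => x x3; have D := delta_numerator x3.
set P := 3 * _ - _ - _ + _ in D *; set Q := 3 * _ + _ + _ + _ + _ + _ in D *.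
have Q0 : 0 < Q by rewrite /Q !ltr_wpDr ?mulr_ge0 ?exprn_ge0 ?mulr_gt0 ?exprn_gt0//; lra.
have x1 : 0 < x + 1 by lra.
rewrite (_ : (x + 1) / 2 * _ = 1 / 2 - (P / Q) / 2); last by field; rewrite !gt_eqF.
have : P / Q <= (16 * (x + 1))^-1.
  by rewrite ler_pdivrMr// mulrC ler_pdivlMr ?mulr_gt0// mulrC.
have -> : (32 * (x + 1))^-1 = (16 * (x + 1))^-1 / 2 by field; rewrite gt_eqF.
by move=> ?; lra.
Qed.

Lemma S_k_trigpoly k (N K al : R) : 0 <= K <= N ->
  S_k k N K al = trigpoly (mu_k R k) (Num.truncn (N - K)) (Num.truncn N) al.
Proof.
move=> /andP[K0 KN]; have NK : 0 <= N - K by rewrite subr_ge0.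
have N0 : 0 <= N by exact: le_trans KN.
rewrite /S_k /trigpoly [RHS](big_nat_widenl _ 0)// big_nat_cond [RHS]big_nat_cond.
apply: eq_bigl => n; rewrite /= ltnS -truncn_lt_nat//.
rewrite truncn_ge_nat//; case: (n%:R <= N); rewrite ?andbT ?andbF//.
Qed.

Lemma expR_inv_powR (k : nat) (K : R) : 0 < K -> K `^ k%:R^-1 = expR (ln K / k%:R).
Proof. by move=> K0; rewrite -{1}[K]lnK ?posrE// -expRM. Qed.

Lemma interval_length (N K : R) : 1 <= K -> K <= N ->
  K - 1 < (Num.truncn N - Num.truncn (N - K))%:R < K + 1.
Proof.
move=> K1 KN; have N0 : 0 <= N by lra.
have NK : 0 <= N - K by lra.
have /andP[v1 v2] := truncn_itv N0; have /andP[u1 u2] := truncn_itv NK.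
have uv : (Num.truncn (N - K) <= Num.truncn N)%N by apply: le_truncn; lra.
rewrite natrB//; move: v2 u2; rewrite -natr1 -[(Num.truncn (N - K)).+1%:R]natr1 => v2 u2.
by apply/andP; split; lra.
Qed.

Lemma ln2_le1 : ln (2 : R) <= 1.
Proof. by apply: (@le_ln1Dx R 1); lra. Qed.

Lemma ln_le_double (x y : R) : 0 < x -> 0 < y -> x <= 2 * y -> ln x <= ln y + 1.
Proof.
move=> x0 y0 xy; apply: (@le_trans _ _ (ln (2 * y))).
  by rewrite ler_ln ?posrE ?mulr_gt0.
by rewrite lnM ?posrE// addrC lerD2l ln2_le1.
Qed.

Lemma upper_conversion (k : nat) (h l : R) : (2 <= k)%N -> 2 <= l -> 0 <= h -> h <= l + 1 ->
  expR (h / k%:R + (2 - k%:R^-1) * ln (1 + h)) <=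
  expR 3 * (expR (l / k%:R) * (l `^ (2 - k%:R^-1))).
Proof.
move=> k2 l2 h0 hl; have K2 : 2 <= k%:R :> R by rewrite ler_nat.
move: (k%:R : R) K2 => K K2.
have V0 : 0 < K^-1 by rewrite invr_gt0; lra.
have V1 : K^-1 <= 1 by rewrite invf_le1; lra.
rewrite -[in l `^ _](lnK (_ : l \is Num.pos)) ?posrE; last by lra.
rewrite -expRM -!expRD ler_expR.
have lnl : ln (1 + h) <= 1 + ln l.
  by rewrite [leRHS]addrC; apply: ln_le_double; lra.
have a : h / K <= l / K + 1.
  have := ler_wpM2r (ltW V0) hl; rewrite mulrDl mul1r => ?; lra.
have b : (2 - K^-1) * ln (1 + h) <= (2 - K^-1) * (1 + ln l) by rewrite ler_wpM2l//; lra.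
by rewrite [ln l * _]mulrC; lra.
Qed.

Lemma lower_conversion (k : nat) (h l : R) : (2 <= k)%N -> 2 <= l -> l - 1 <= h ->
  expR (- 1) / 2 * (expR (l / k%:R) * l) <= expR (h / k%:R) * h.
Proof.
move=> k2 l2 hl; have K2 : 2 <= k%:R :> R by rewrite ler_nat.
move: (k%:R : R) K2 => K K2.
have V0 : 0 < K^-1 by rewrite invr_gt0; lra.
have V1 : K^-1 <= 1 by rewrite invf_le1; lra.
rewrite (_ : _ * (_ * l) = expR (- 1) * expR (l / K) * (l / 2)); last by field.
rewrite -expRD; apply: ler_pM; [exact: expR_ge0|lra| |lra].
rewrite ler_expR.
by have := ler_wpM2r (ltW V0) hl; rewrite mulrBl mul1r => ?; lra.
Qed.

End Conversions.

Unset Implicit Arguments.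

Theorem corollary1p6 (R : realType) (k : nat) (hk : (2 <= k)%N)
    (eps : R) (heps : 0 < eps) (c : R) (hc : 0 < c) :
  exists C1 C2 N0 : R,
    [/\ 0 < C1, 0 < C2 &
      forall N K : R, N0 <= N -> 1 <= K -> K <= N ->
        c * N `^ ((k%:R + 1) / 2 * delta R k + eps) <= K ->
        C1 * (K `^ (k%:R^-1) * ln K) <= moment k N K /\
        moment k N K <= C2 * (K `^ (k%:R^-1) * ln K `^ (2 - k%:R^-1))].
Proof.
have k0 : 0 < k%:R :> R by rewrite ltr0n ltnW.
pose c1 : R := 16^-1 ^+ 2 / 1024 / (48 * k%:R).
have c1_gt0 : 0 < c1.
  apply: divr_gt0; last by apply: mulr_gt0; [rewrite ltr0n|].
  apply: divr_gt0; last by rewrite ltr0n.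
  by apply: exprn_gt0; rewrite invr_gt0 ltr0n.
pose c2 : R := 1 + 2 * (640 + 16 * tail_weight R k).
have c2_gt0 : 0 < c2.
  have : 0 <= tail_weight R k by rewrite mulr_ge0 ?exprn_ge0// addr_ge0 ?mulr_ge0.
  by rewrite /c2; move: (tail_weight R k) => m m0; lra.
pose b1 : R := 6 * ln (64 * (24 + 6 * k%:R)).
pose b2 : R := 12 * k%:R * ln 64.
have b1_ge0 : 0 <= b1.
  rewrite mulr_ge0// ln_ge0// -natrM -natrD -natrM ler1n muln_gt0 /=; lia.
have b2_ge0 : 0 <= b2 by rewrite !mulr_ge0 ?ler0n// ln_ge0// ler1n.
pose b := 2 + b1 + b2.
(* For log N >= (b - log c) / eps the factor N^eps outweighs e^b / c, so that
   K >= e^b N^th with th = ((k+1)/2) delta_k. *)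
exists (c1 * (expR (- 1) / 2)), (c2 * expR 3), (expR ((b - ln c) / eps)).
split; [by rewrite mulr_gt0// divr_gt0// expR_gt0|by rewrite mulr_gt0// expR_gt0|].
move=> N K N0N K1 KN hyp.
have N1 : 1 <= N by exact: le_trans KN.
have K0 : 0 < K by apply: lt_le_trans K1.
have Npos : 0 < N by apply: lt_le_trans N1.
set u := Num.truncn (N - K); set v := Num.truncn N.
have /andP[HK1 HK2] := interval_length K1 KN; rewrite -/u -/v in HK1 HK2.
have n0 : 0 <= ln N by apply: ln_ge0.
have n_ge : b - ln c <= eps * ln N.
  have : (b - ln c) / eps <= ln N by rewrite -ler_expR lnK ?posrE.
  by rewrite ler_pdivrMr// mulrC.
pose th := (k%:R + 1) / 2 * delta R k.
have th_ge : 1 / 2 - eta R k <= th by exact: half_sub_eta_le_delta.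
have eta_le : eta R k <= 1 / 2.
  by have := ler0n R k; rewrite /eta mul1r => ?; rewrite lef_pV2 ?posrE; lra.
have lnK_ge : ln c + (th + eps) * ln N <= ln K.
  have : ln (c * N `^ (th + eps)) <= ln K.
    by rewrite ler_ln ?posrE ?mulr_gt0 ?powR_gt0.
  by rewrite lnM ?posrE ?powR_gt0// ln_powR.
have thn : (1 / 2 - eta R k) * ln N <= th * ln N by exact: ler_wpM2r.
have thn0 : 0 <= (1 / 2 - eta R k) * ln N by rewrite mulr_ge0//; lra.
have lnKb : b <= ln K by lra.
have l2 : 2 <= ln K by rewrite /b in lnKb; lra.
have K2 : 2 <= K.
  have := @le_ln1Dx R (K - 1); rewrite (_ : 1 + (K - 1) = K); last by ring.
  move=> h.
  have : ln K <= K - 1 by apply: h; lra.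
  by move=> ?; lra.
have uv : (u < v)%N by rewrite -subn_gt0 -(ltr0n R); lra.
set h := ln (v - u)%:R : R.
have H0 : 0 < (v - u)%:R :> R by rewrite ltr0n subn_gt0.
have hK : h <= ln K + 1 by apply: ln_le_double => //; lra.
have Kh : ln K - 1 <= h by rewrite lerBlDr; apply: ln_le_double => //; lra.
have h0 : 0 <= h by lra.
have hypH : (1 - 2 * eta R k) * ln v%:R <= 2 * h.
  have vN : ln v%:R <= ln N.
    rewrite ler_ln ?posrE// ?ltr0n ?(leq_trans _ uv)// truncn_le; exact: ltW.
  apply: (@le_trans _ _ ((1 - 2 * eta R k) * ln N)); first by rewrite ler_wpM2l//; lra.
  by rewrite /b in n_ge; lra.
have momE : moment k N K = int01 (fun al => cmod (trigpoly (mu_k R k) u v al) `^ (1 + k%:R^-1)).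
  rewrite /moment /int01; apply: eq_Rintegral => al _; rewrite S_k_trigpoly//.
  by rewrite KN (ltW K0).
rewrite momE (expR_inv_powR k K0); split.
  have := moment_lower hk uv hypH; rewrite -/h -/b1 -/b2 -/c1 => low.
  have [h1 h2] : b1 <= h /\ b2 <= h by rewrite /b in lnKb; split; lra.
  apply: le_trans (low h1 h2).
  by rewrite -mulrA (ler_pM2l c1_gt0) lower_conversion.
apply: le_trans (moment_upper hk uv hypH) _; rewrite -/h -/c2 -mulrA (ler_pM2l c2_gt0).
exact: upper_conversion.
Qed.
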